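(* Let $X$ and $Y$ be disjoint sets, each of cardinality at least two, and let $M \le \mathrm{Sym}(X)$ and $N \le \mathrm{Sym}(Y)$ be permutation groups that are both generated by point stabilisers, with at least one of $M$, $N$ nontrivial. Then the box product $M \boxtimes N$ is simple if and only if $M$ or $N$ is transitive.
   Context: A permutation group $G \le \mathrm{Sym}(V)$ is generated by point stabilisers if $G = \langle G_\alpha : \alpha \in V\rangle$. Let $T$ be the $(|X|,|Y|)$-biregular tree, with natural bipartition $VT = V_X \sqcup V_Y$, where vertices of $V_X$ have valency $|X|$ and vertices of $V_Y$ have valency $|Y|$. Arcs are ordered pairs of adjacent vertices; $A(v)$ (resp. $\overline{A}(v)$) denotes the set of arcs with origin (resp. terminus) $v$. A legal colouring is a map $c: AT \to X\cup Y$ such that $c|_{A(v)}$ is a bijection onto $X$ for $v\in V_X$, onto $Y$ for $v \in V_Y$, and $c$ is constant on $\overline{A}(v)$ for all $v$. $U_c(M,N)$ is the group of $g\in\mathrm{Aut}(T)$ with $gV_X=V_X$ such that $c|_{A(gv)}\circ g|_{A(v)}\circ (c|_{A(v)})^{-1}$ lies in $M$ for all $v\in V_X$ and in $N$ for all $v\in V_Y$. The box product $M\boxtimes N$ is the subgroup of $\mathrm{Sym}(V_Y)$ induced by $U_c(M,N)$ (independent of $c$ up to permutation isomorphism). *)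

(* Defs.v *)
From Stdlib Require Import Arith.

Definition perm_group {X : Type} (G : (X -> X) -> Prop) : Prop :=
  G (fun x => x) /\
  (forall g h, G g -> G h -> G (fun x => g (h x))) /\
  (forall g, G g -> exists h, G h /\ (forall x, h (g x) = x) /\ (forall x, g (h x) = x)).

Definition generated {X : Type} (S : (X -> X) -> Prop) (g : X -> X) : Prop :=
  forall H : (X -> X) -> Prop, perm_group H -> (forall s, S s -> H s) -> H g.

Definition stabiliser {X : Type} (G : (X -> X) -> Prop) (a : X) (g : X -> X) : Prop :=
  G g /\ g a = a.

Definition gen_by_point_stabilisers {X : Type} (G : (X -> X) -> Prop) : Prop :=
  forall g, G g -> generated (fun s => exists a, stabiliser G a s) g.

Definition transitive {X : Type} (G : (X -> X) -> Prop) : Prop :=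
  forall a b : X, exists g, G g /\ g a = b.

Definition nontrivial {X : Type} (G : (X -> X) -> Prop) : Prop :=
  exists g, G g /\ exists x, g x <> x.

Definition at_least_two (X : Type) : Prop := exists x1 x2 : X, x1 <> x2.

Definition normal_subgroup {V : Type} (K G : (V -> V) -> Prop) : Prop :=
  perm_group K /\ (forall k, K k -> G k) /\
  (forall g ginv k, G g -> (forall x, ginv (g x) = x) -> (forall x, g (ginv x) = x) ->
     K k -> K (fun x => g (k (ginv x)))).

Definition simple_perm_group {V : Type} (G : (V -> V) -> Prop) : Prop :=
  perm_group G /\ nontrivial G /\
  forall K, normal_subgroup K G ->
    (forall k, K k -> forall x, k x = x) \/ (forall g, G g -> K g).

(* A (simple, undirected) tree: nonempty, adjacency irreflexive and symmetric,
   connected, and without cycles (no closed non-backtracking walk of positive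
   length). Walks are given as w : nat -> V restricted to 0..n. *)
Definition walk {V : Type} (adj : V -> V -> Prop) (w : nat -> V) (n : nat) : Prop :=
  forall i, i < n -> adj (w i) (w (S i)).

Definition is_tree {V : Type} (adj : V -> V -> Prop) : Prop :=
  inhabited V /\
  (forall v, ~ adj v v) /\
  (forall u v, adj u v -> adj v u) /\
  (forall u v, exists w n, walk adj w n /\ w 0 = u /\ w n = v) /\
  (forall w n, walk adj w n -> (forall i, i + 2 <= n -> w i <> w (i + 2)) ->
      1 <= n -> w 0 <> w n).

Definition bipartition {V : Type} (adj : V -> V -> Prop) (inVX : V -> Prop) : Prop :=
  forall u v, adj u v -> (inVX u <-> ~ inVX v).

(* Legal colouring c : AT -> X ⊔ Y; the arc (u,v) (origin u, terminus v) gets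
   colour c u v (values of c on non-arcs are irrelevant).  For v in V_X,
   c restricted to A(v) is a bijection onto X; for v in V_Y onto Y; and c is
   constant on the set of arcs with terminus v. *)
Definition legal_colouring {X Y V : Type} (adj : V -> V -> Prop) (inVX : V -> Prop)
    (c : V -> V -> X + Y) : Prop :=
  (forall v, inVX v ->
     (forall u, adj v u -> exists x, c v u = inl x) /\
     (forall u u', adj v u -> adj v u' -> c v u = c v u' -> u = u') /\
     (forall x, exists u, adj v u /\ c v u = inl x)) /\
  (forall v, ~ inVX v ->
     (forall u, adj v u -> exists y, c v u = inr y) /\
     (forall u u', adj v u -> adj v u' -> c v u = c v u' -> u = u') /\
     (forall y, exists u, adj v u /\ c v u = inr y)) /\
  (forall v u w, adj u v -> adj w v -> c u v = c w v).

Definition tree_aut {V : Type} (adj : V -> V -> Prop) (g : V -> V) : Prop :=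
  (exists h : V -> V, (forall v, h (g v) = v) /\ (forall v, g (h v) = v)) /\
  (forall u v, adj u v <-> adj (g u) (g v)).

(* U_c(M,N): g in Aut(T) with g V_X = V_X such that, for each v, the local
   permutation  c|_{A(gv)} ∘ g|_{A(v)} ∘ (c|_{A(v)})^{-1}  lies in M (v in V_X)
   resp. N (v in V_Y).  The local permutation is described by its graph:
   sigma (colour of (v,u)) = colour of (gv, gu). *)
Definition U_c {X Y V : Type} (adj : V -> V -> Prop) (inVX : V -> Prop)
    (c : V -> V -> X + Y) (M : (X -> X) -> Prop) (N : (Y -> Y) -> Prop)
    (g : V -> V) : Prop :=
  tree_aut adj g /\
  (forall v, inVX (g v) <-> inVX v) /\
  (forall v, inVX v -> exists sigma, M sigma /\
      forall u x, adj v u -> c v u = inl x -> c (g v) (g u) = inl (sigma x)) /\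
  (forall v, ~ inVX v -> exists sigma, N sigma /\
      forall u y, adj v u -> c v u = inr y -> c (g v) (g u) = inr (sigma y)).

Definition VY {V : Type} (inVX : V -> Prop) : Type := { v : V | ~ inVX v }.

Definition box_product {X Y V : Type} (adj : V -> V -> Prop) (inVX : V -> Prop)
    (c : V -> V -> X + Y) (M : (X -> X) -> Prop) (N : (Y -> Y) -> Prop)
    (f : VY inVX -> VY inVX) : Prop :=
  exists g, U_c adj inVX c M N g /\ forall y : VY inVX, proj1_sig (f y) = g (proj1_sig y).

(* Main.v *)
(* Write G for U_c(M,N); it acts faithfully on V_Y, so simplicity may be tested on G.

   If M (say) is transitive, let 1 <> K be normal in G.  An element of K moving a vertex
   either translates a half-tree into itself or, multiplied by a suitable conjugate, yields
   an element h of K that does.  A half-tree T branching off the axis of h has pairwise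
   disjoint translates, and then every f in the rigid stabiliser of T is a commutator
   [F, h] with F the infinite product of the h^n f h^-n; hence f is in K.  By transitivity
   and nesting, K contains the rigid stabilisers of all half-trees, and these generate G
   because M and N are generated by point stabilisers.

   If M and N are both intransitive, the quotient graph of the tree by G is complete
   bipartite with at least two vertices on each side.  Counting signed passages through
   one of its edges gives a nonzero homomorphism from G to Z that kills all vertex
   stabilisers, so its kernel is a proper nontrivial normal subgroup. *)
From Stdlib Require Import Bool Lia ZArith Classical ClassicalEpsilon FunctionalExtensionality PropExtensionality Relations.
Require Import Defs.
From Stdlib Require Import Arith.

Arguments clos_refl_trans {A}.

(** * Walks and reflexive transitive closures *)

Lemma rt_map {A B : Type} (R : A -> A -> Prop) (S : B -> B -> Prop) (f : A -> B) :
  (forall a b, R a b -> S (f a) (f b)) ->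
  forall a b, clos_refl_trans R a b -> clos_refl_trans S (f a) (f b).
Proof.
  intros HRS a b H; induction H.
  - apply rt_step; auto.
  - apply rt_refl.
  - eapply rt_trans; eauto.
Qed.

Lemma rt_sym {A : Type} (R : A -> A -> Prop) :
  (forall a b, R a b -> R b a) ->
  forall a b, clos_refl_trans R a b -> clos_refl_trans R b a.
Proof.
  intros HR a b H; induction H.
  - apply rt_step; auto.
  - apply rt_refl.
  - eapply rt_trans; eauto.
Qed.

Lemma rt_invariant {A : Type} (R : A -> A -> Prop) (P : A -> Prop) (a : A) :
  P a -> (forall b c, P b -> R b c -> P c) -> forall b, clos_refl_trans R a b -> P b.
Proof.
  intros Ha HP b H.
  induction H using clos_refl_trans_ind_left; eauto.
Qed.

Lemma walk_rt {A : Type} (R : A -> A -> Prop) (w : nat -> A) (n : nat) :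
  walk R w n -> clos_refl_trans R (w 0) (w n).
Proof.
  induction n as [|n IH]; intros H.
  - apply rt_refl.
  - apply rt_trans with (w n).
    + apply IH; intros i Hi; apply H; lia.
    + apply rt_step, H; lia.
Qed.

Lemma rt_walk {A : Type} (R : A -> A -> Prop) (a b : A) :
  clos_refl_trans R a b -> exists w n, walk R w n /\ w 0 = a /\ w n = b.
Proof.
  intros H.
  induction H as [|b c _ (w & n & Hw & H0 & Hn) Hbc] using clos_refl_trans_ind_left.
  - exists (fun _ => a), 0; repeat split; intros i Hi; lia.
  - exists (fun i => if i <=? n then w i else c), (S n); split; [|split].
    + intros i Hi.
      destruct (Nat.leb_spec i n), (Nat.leb_spec (S i) n); try lia.
      * apply Hw; lia.
      * replace i with n by lia; congruence.
    + destruct (Nat.leb_spec 0 n); [assumption|lia].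
    + destruct (Nat.leb_spec (S n) n); [lia|reflexivity].
Qed.

(* A shortest path in the covering graph does not backtrack, hence neither does its
   image; so if the image closes up in a tree, the path is trivial. *)
Lemma cover_injective {V P : Type} (adj : V -> V -> Prop) (adjP : P -> P -> Prop) (pi : P -> V) :
  is_tree adj ->
  (forall p q, adjP p q -> adj (pi p) (pi q)) ->
  (forall p q r, adjP p q -> adjP q r -> pi p = pi r -> p = r) ->
  forall p q, clos_refl_trans adjP p q -> pi p = pi q -> p = q.
Proof.
  intros (_ & _ & _ & _ & Hacyc) Hadj Hinj p q Hpq.
  destruct (rt_walk _ _ _ Hpq) as (w & n & Hw & <- & <-); clear Hpq.
  revert w Hw.
  induction n as [n IH] using (well_founded_induction lt_wf); intros w Hw Hpi.
  destruct n as [|n]; [reflexivity|].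
  destruct (classic (exists i, i + 2 <= S n /\ w i = w (i + 2))) as [(i & Hi & Hback)|Hnb].
  - set (w' := fun j => if j <=? i then w j else w (j + 2)).
    assert (E0 : w' 0 = w 0) by reflexivity.
    assert (En : w' (S n - 2) = w (S n)).
    { unfold w'; destruct (Nat.leb_spec (S n - 2) i).
      - replace (S n - 2) with i by lia; rewrite Hback; f_equal; lia.
      - f_equal; lia. }
    rewrite <- E0, <- En; apply IH; [lia| |rewrite E0, En; exact Hpi].
    intros j Hj; unfold w'.
    destruct (Nat.leb_spec j i), (Nat.leb_spec (S j) i); try lia.
    + apply Hw; lia.
    + replace j with i by lia; rewrite Hback.
      replace (S i + 2) with (S (i + 2)) by lia; apply Hw; lia.
    + replace (S j + 2) with (S (j + 2)) by lia; apply Hw; lia.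
  - exfalso; apply (Hacyc (fun i => pi (w i)) (S n)); [| |lia|exact Hpi].
    + intros i Hi; apply Hadj, Hw, Hi.
    + intros i Hi E; apply Hnb; exists i; split; [exact Hi|].
      replace (i + 2) with (S (S i)) in * by lia.
      apply Hinj with (w (S i)); [apply Hw; lia|apply Hw; lia|exact E].
Qed.

Lemma choice_function {A B : Type} (R : A -> B -> Prop) :
  (forall a, exists b, R a b) -> exists f, forall a, R a (f a).
Proof.
  intros H; exists (fun a => proj1_sig (constructive_indefinite_description _ (H a))).
  intros a; apply proj2_sig.
Qed.

(** * Half-trees *)

Section Half_trees.

Context {V : Type} {adj : V -> V -> Prop} (Htree : is_tree adj).

(** For adjacent [u] and [v] this is the half-tree on the side of [v]: the vertices reached from [v]
    by walks that never enter [u]. *)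
Definition half (u v : V) : V -> Prop := clos_refl_trans (fun a b => adj a b /\ b <> u) v.

Lemma adj_sym u v : adj u v -> adj v u.
Proof. apply Htree. Qed.

Lemma adj_neq u v : adj u v -> u <> v.
Proof. intros H <-; revert H; apply Htree. Qed.

Lemma tree_connected u v : clos_refl_trans adj u v.
Proof.
  destruct Htree as (_ & _ & _ & Hconn & _).
  destruct (Hconn u v) as (w & n & Hw & <- & <-); apply walk_rt, Hw.
Qed.

Lemma half_base u v : half u v v.
Proof. apply rt_refl. Qed.

Lemma half_step u v a b : half u v a -> adj a b -> b <> u -> half u v b.
Proof. intros H ? ?; apply rt_trans with a; [exact H|apply rt_step; auto]. Qed.

Lemma half_ind u v (P : V -> Prop) :
  P v -> (forall a b, half u v a -> P a -> adj a b -> half u v b -> b <> u -> P b) ->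
  forall a, half u v a -> P a.
Proof.
  intros Hv HP a H.
  enough (half u v a /\ P a) by tauto.
  revert a H; apply rt_invariant; [split; [apply half_base|exact Hv]|].
  intros a b [Ha Pa] [Hab Hb]; pose proof (half_step _ _ _ _ Ha Hab Hb); eauto.
Qed.

Lemma half_origin u v : adj u v -> ~ half u v u.
Proof.
  intros Huv.
  enough (H : forall a, half u v a -> a <> u) by (intros Hu; now apply (H u)).
  apply half_ind; [intros ->; now apply (adj_neq u u)|auto].
Qed.

Lemma half_root u v w : adj u v -> half u v w -> adj w u -> w = v.
Proof.
  intros Huv Hw Hwu; apply NNPP; intros Hne.
  (* The double cover below cuts the tree at [u], splitting [u] into a copy attached
     to [v] and a copy attached to [w]. *)
  set (adjP := fun p q : V * bool => adj (fst p) (fst q) /\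
    ((snd p = true /\ snd q = true /\ fst q <> u /\ (fst p = u -> fst q = v)) \/
     (p = (w, true) /\ q = (u, false)))).
  enough (E : (u, true) = (u, false)) by discriminate.
  apply (cover_injective adj adjP fst Htree); [intros p q H; apply H| | |reflexivity].
  - intros [p i] [q j] [r k] [H1 H1'] [H2 H2'] E; simpl in *; subst r.
    destruct H1' as [(-> & -> & Hq & Hp)|[[= -> ->] [= -> ->]]].
    + destruct H2' as [(_ & -> & _)|[[= ->] [= -> ->]]]; [reflexivity|].
      exfalso; apply Hne; auto.
    + destruct H2' as [(? & _)|[[=] _]]; discriminate.
  - apply rt_trans with (w, true).
    + apply rt_trans with (v, true).
      * apply rt_step; split; [exact Huv|left; simpl; repeat split; auto].
        intros ->; now apply (adj_neq u u).
      * assert (H : forall a, half u v a -> clos_refl_trans adjP (v, true) (a, true)).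
        { apply (half_ind u v); [apply rt_refl|].
          intros a b Ha IH Hab _ Hb; apply rt_trans with (a, true); [exact IH|].
          apply rt_step; split; [exact Hab|left; simpl; repeat split; auto].
          intros ->; now apply half_origin in Ha. }
        now apply H.
    + apply rt_step; split; [exact Hwu|right; auto].
Qed.
Lemma half_exit u v a b : adj u v -> half u v a -> adj a b -> ~ half u v b -> a = v /\ b = u.
Proof.
  intros Huv Ha Hab Hb.
  assert (b = u) as -> by (apply NNPP; intros Hne; apply Hb; eapply half_step; eauto).
  split; [now apply (half_root u v)|reflexivity].
Qed.

(** A walk from [u] that never enters [v] could reach the other side only through their common edge,
    by [half_exit]. Conversely, a step of a walk cannot leave the union of the two sides, so
    connectedness gives the whole tree. *)
Lemma half_opposite u v a : adj u v -> (half v u a <-> ~ half u v a).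
Proof.
  intros Huv; split.
  - revert a; apply half_ind; [now apply half_origin|].
    intros a b _ Ha Hab _ Hb Hb'.
    destruct (half_exit u v b a Huv Hb' (adj_sym _ _ Hab) Ha); contradiction.
  - enough (half u v a \/ half v u a) by tauto.
    apply (rt_invariant adj (fun a => half u v a \/ half v u a) v);
      [left; apply half_base| |apply tree_connected].
    intros b c [Hb|Hb] Hbc.
    + destruct (classic (c = u)) as [->|Hc]; [right; apply half_base|left; eapply half_step; eauto].
    + destruct (classic (c = v)) as [->|Hc]; [left; apply half_base|right; eapply half_step; eauto].
Qed.

(** A walk inside [half u v] never meets [u'], which lies outside, so it is also a walk of
    [half u' v']. *)
Lemma half_subset u v u' v' :
  ~ half u v u' -> half u' v' v -> forall a, half u v a -> half u' v' a.
Proof.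
  intros Hu' Hv; apply half_ind; [exact Hv|].
  intros a b _ Ha Hab Hb _; apply half_step with a; auto.
  intros ->; contradiction.
Qed.

Lemma half_disjoint v s s' a : adj v s -> adj v s' -> s <> s' -> half v s a -> ~ half v s' a.
Proof.
  intros Hs Hs' Hne Ha; apply half_opposite; [exact Hs'|].
  revert a Ha; apply half_subset.
  - intros H; apply Hne; symmetry; apply (half_root v s); auto using adj_sym.
  - apply half_step with v; auto using half_base, adj_sym.
Qed.

Lemma half_subset_next u v s :
  adj u v -> adj v s -> s <> u -> forall a, half v s a -> half u v a.
Proof.
  intros Hu Hs Hne a Ha; apply half_opposite; [now apply adj_sym|].
  apply half_disjoint with s; auto using adj_sym.
Qed.

Lemma half_towards w x : w <> x -> exists z, adj w z /\ half w z x.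
Proof.
  enough (H : x = w \/ exists z, adj w z /\ half w z x) by (intros Hne; destruct H; congruence).
  apply (rt_invariant adj (fun x => x = w \/ exists z, adj w z /\ half w z x) w);
    [now left| |apply tree_connected].
  intros b c [->|(z & Hz & Hb)] Hbc.
  - right; exists c; auto using half_base.
  - destruct (classic (c = w)) as [->|Hc]; [now left|].
    right; exists z; split; [exact Hz|eapply half_step; eauto].
Qed.

Lemma half_aut g u v a : tree_aut adj g -> (half (g u) (g v) (g a) <-> half u v a).
Proof.
  intros [(h & Hhg & Hgh) Hg]; split; intros H.
  - rewrite <- (Hhg v), <- (Hhg a); revert H.
    apply rt_map; intros b c [Hbc Hc]; split.
    + apply Hg; now rewrite !Hgh.
    + intros <-; now apply Hc.
  - revert H; apply rt_map; intros b c [Hbc Hc]; split.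
    + now apply Hg in Hbc.
    + intros E; apply Hc; rewrite <- (Hhg c), <- (Hhg u); now rewrite E.
Qed.

End Half_trees.

(** * Groups with prescribed local actions *)

(* [col v] is the common colour of the arcs ending at [v]; [kind] separates [X] from [Y]
   inside the set [C] of colours; [L] consists of the permutations of [C] that act as an
   element of [M] on [X] and as an element of [N] on [Y]. *)
Record coloured_tree {V C : Type} (adj : V -> V -> Prop) (col : V -> C) (kind : C -> bool)
    (L : (C -> C) -> Prop) : Prop := {
  ct_tree : is_tree adj;
  ct_kind : forall u v, adj u v -> kind (col u) <> kind (col v);
  ct_col_inj : forall v u u', adj v u -> adj v u' -> col u = col u' -> u = u';
  ct_col_surj : forall v c, kind c <> kind (col v) -> exists u, adj v u /\ col u = c;
  ct_two : forall k, exists c c', c <> c' /\ kind c = k /\ kind c' = k;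
  ct_group : perm_group L;
  ct_L_kind : forall t c, L t -> kind (t c) = kind c;
  ct_L_mix : forall s t, L s -> L t -> L (fun c => if kind c then s c else t c)
}.

(** The form of [U_c] used below. The arc from [v] to [u] has colour [col u], so at [v] only the
    values of [t] on colours of the kind opposite to [col v] matter. *)
Definition local_group {V C : Type} (adj : V -> V -> Prop) (col : V -> C) (L : (C -> C) -> Prop)
    (g : V -> V) : Prop :=
  tree_aut adj g /\ forall v, exists t, L t /\ forall u, adj v u -> col (g u) = t (col u).

Arguments ct_tree {V C adj col kind L}.
Arguments ct_kind {V C adj col kind L}.
Arguments ct_col_inj {V C adj col kind L}.
Arguments ct_col_surj {V C adj col kind L}.
Arguments ct_two {V C adj col kind L}.
Arguments ct_group {V C adj col kind L}.
Arguments ct_L_kind {V C adj col kind L}.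
Arguments ct_L_mix {V C adj col kind L}.

Lemma perm_group_inj {A : Type} (G : (A -> A) -> Prop) g a b :
  perm_group G -> G g -> g a = g b -> a = b.
Proof.
  intros (_ & _ & Hinv) Hg E; destruct (Hinv g Hg) as (h & _ & Hh & _).
  now rewrite <- (Hh a), <- (Hh b), E.
Qed.

Lemma perm_group_iter {A : Type} (G : (A -> A) -> Prop) g n :
  perm_group G -> G g -> G (fun a => Nat.iter n g a).
Proof.
  intros (Hid & Hcomp & _) Hg; induction n as [|n IH]; [exact Hid|].
  exact (Hcomp _ _ Hg IH).
Qed.

Section Coloured_trees.

Context {V C : Type} {adj : V -> V -> Prop} {col : V -> C} {kind : C -> bool}
  {L : (C -> C) -> Prop} (HT : coloured_tree adj col kind L).

Local Notation G := (local_group adj col L).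
Local Notation half := (half (adj := adj)).

Let Htree : is_tree adj := ct_tree HT.
Let Hsym : forall u v, adj u v -> adj v u := adj_sym Htree.

Lemma local_group_perm_group : perm_group G.
Proof.
  destruct (ct_group HT) as (Lid & Lcomp & Linv).
  split; [|split].
  - split; [split; [now exists (fun v => v)|tauto]|].
    intros v; exists (fun c => c); auto.
  - intros g h [[(g' & Hg1 & Hg2) Hg] Lg] [[(h' & Hh1 & Hh2) Hh] Lh]; split; [split|].
    + exists (fun v => h' (g' v)); split; intros v; congruence.
    + intros u v; rewrite (Hh u v); apply Hg.
    + intros v; destruct (Lh v) as (t & Ht & Et), (Lg (h v)) as (s & Hs & Es).
      exists (fun c => s (t c)); split; [now apply Lcomp|].
      intros u Hu; rewrite Es by now apply (Hh v u).
      now rewrite Et.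
  - intros g [[(h & Hhg & Hgh) Hg] Lg]; exists h; repeat split; auto.
    + now exists g.
    + intros H; apply Hg; now rewrite !Hgh.
    + intros H; apply Hg in H; now rewrite !Hgh in H.
    + intros v; destruct (Lg (h v)) as (t & Ht & Et), (Linv t Ht) as (s & Hs & Hst & Hts).
      exists s; split; [exact Hs|]; intros u Hu.
      rewrite <- (Hgh u) at 2; rewrite Et, Hst; [reflexivity|].
      apply Hg; now rewrite !Hgh.
Qed.

Lemma kind_neighbour u v : adj u v -> kind (col u) = negb (kind (col v)).
Proof.
  intros Huv; pose proof (ct_kind HT _ _ Huv) as H.
  now destruct (kind (col u)), (kind (col v)).
Qed.

Lemma neighbour v : exists u, adj v u.
Proof.
  destruct (ct_two HT (negb (kind (col v)))) as (c & _ & _ & Hc & _).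
  destruct (ct_col_surj HT v c) as (u & Hu & _); [|now exists u].
  rewrite Hc; apply no_fixpoint_negb.
Qed.

Lemma other_neighbour v u : exists s, adj v s /\ s <> u.
Proof.
  destruct (ct_two HT (negb (kind (col v)))) as (c & c' & Hne & Hc & Hc').
  destruct (ct_col_surj HT v c) as (s & Hs & Es); [rewrite Hc; apply no_fixpoint_negb|].
  destruct (ct_col_surj HT v c') as (s' & Hs' & Es'); [rewrite Hc'; apply no_fixpoint_negb|].
  destruct (classic (s = u)) as [->|Hsu]; [|now exists s].
  exists s'; split; [exact Hs'|congruence].
Qed.

Lemma local_group_kind g v : G g -> kind (col (g v)) = kind (col v).
Proof.
  intros [_ Hg]; destruct (neighbour v) as (u & Hu), (Hg u) as (t & Ht & E).
  rewrite E by (apply Hsym, Hu); now apply (ct_L_kind HT).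
Qed.

(** Membership in [G] is a condition on the neighbourhood of each vertex, which is what allows
    elements to be glued. *)
Lemma local_group_local f f' :
  (forall v, f' (f v) = v) -> (forall v, f (f' v) = v) ->
  (forall v, exists g, G g /\ g v = f v /\ forall u, adj v u -> g u = f u) ->
  G f.
Proof.
  intros Hf'f Hff' H; split; [split; [now exists f'|]|].
  - intros u v; destruct (H u) as (g & [[(g' & Hg'g & Hgg') Hg] _] & Eu & Ev); split; intros Huv.
    + rewrite <- Eu, <- Ev by exact Huv; now apply (Hg u v).
    (* As [g] agrees with [f] at [u], the vertex [g' (f v)] is a neighbour of [u]; [f] agrees with
       [g] there as well, so this vertex is [v]. *)
    + rewrite <- Eu, <- (Hgg' (f v)) in Huv; apply Hg in Huv.
      pose proof (Ev _ Huv) as E; rewrite Hgg' in E.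
      now rewrite <- (Hf'f v), E, Hf'f.
  - intros v; destruct (H v) as (g & [_ Lg] & _ & Eg), (Lg v) as (t & Ht & Et).
    exists t; split; [exact Ht|]; intros u Hu; rewrite <- Eg by exact Hu; auto.
Qed.

(* The pairs [(w, w')] with [w'] of the colour prescribed by [t] form a graph covering
   the tree in both coordinates, so its components are graphs of automorphisms. *)
Lemma extend_colour_permutation t u u' :
  L t -> col u' = t (col u) ->
  exists g, G g /\ g u = u' /\ forall w, col (g w) = t (col w).
Proof.
  intros Ht Huu'.
  assert (Hinj : forall a b, t a = t b -> a = b)
    by (intros a b; exact (perm_group_inj L t a b (ct_group HT) Ht)).
  destruct (ct_group HT) as (_ & _ & Linv), (Linv t Ht) as (s & Hs & _ & Hts).
  set (ok := fun p : V * V => col (snd p) = t (col (fst p))).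
  set (adjP := fun p q : V * V => ok p /\ ok q /\ adj (fst p) (fst q) /\ adj (snd p) (snd q)).
  set (D := clos_refl_trans adjP (u, u')).
  assert (Dok : forall p, D p -> ok p)
    by (apply rt_invariant; [exact Huu'|intros p q _ Hpq; apply Hpq]).
  assert (Dsym : forall p q, D p -> D q -> clos_refl_trans adjP p q).
  { intros p q Hp Hq; apply rt_trans with (u, u'); [|exact Hq].
    revert Hp; apply rt_sym; intros a b (? & ? & ? & ?); repeat split; auto using Hsym. }
  (* Edges lift from either coordinate: the colour required of the new vertex has the right kind
     because [t] and its inverse preserve kinds. *)
  assert (fwd : forall a a' b, D (a, a') -> adj a b -> exists b', adj a' b' /\ D (b, b')).
  { intros a a' b Ha Hab; pose proof (Dok _ Ha) as Ea; unfold ok in Ea; simpl in Ea.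
    destruct (ct_col_surj HT a' (t (col b))) as (b' & Hb' & Eb).
    - rewrite Ea, !(ct_L_kind HT) by assumption.
      apply not_eq_sym, (ct_kind HT), Hab.
    - exists b'; split; [exact Hb'|].
      eapply rt_trans; [exact Ha|apply rt_step; repeat split; assumption]. }
  assert (bwd : forall a a' b', D (a, a') -> adj a' b' -> exists b, adj a b /\ D (b, b')).
  { intros a a' b' Ha Hab; pose proof (Dok _ Ha) as Ea; unfold ok in Ea; simpl in Ea.
    destruct (ct_col_surj HT a (s (col b'))) as (b & Hb & Eb).
    - rewrite (ct_L_kind HT) by assumption.
      rewrite <- (ct_L_kind HT t (col a)), <- Ea by assumption.
      apply not_eq_sym, (ct_kind HT), Hab.
    - exists b; split; [exact Hb|].
      eapply rt_trans; [exact Ha|apply rt_step; repeat split; try assumption].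
      unfold ok; simpl; now rewrite Eb, Hts. }
  assert (uniq1 : forall a a1 a2, D (a, a1) -> D (a, a2) -> a1 = a2).
  { intros a a1 a2 H1 H2; enough ((a, a1) = (a, a2)) by congruence.
    apply (cover_injective adj adjP fst Htree); [intros p q H; apply H| |auto|reflexivity].
    intros [p p'] [q q'] [r r'] (? & ? & ? & ?) (? & ? & ? & ?) E; unfold ok in *; simpl in *; subst.
    f_equal; apply (ct_col_inj HT q'); auto using Hsym; congruence. }
  assert (uniq2 : forall a1 a2 a, D (a1, a) -> D (a2, a) -> a1 = a2).
  { intros a1 a2 a H1 H2; enough ((a1, a) = (a2, a)) by congruence.
    apply (cover_injective adj adjP snd Htree); [intros p q H; apply H| |auto|reflexivity].
    intros [p p'] [q q'] [r r'] (? & ? & ? & ?) (? & ? & ? & ?) E; unfold ok in *; simpl in *; subst.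
    f_equal; apply (ct_col_inj HT q); auto using Hsym.
    apply Hinj; congruence. }
  assert (H0 : D (u, u')) by apply rt_refl.
  assert (tot1 : forall a, exists a', D (a, a')).
  { intros a; apply (rt_invariant adj (fun a => exists a', D (a, a')) u);
      [eauto| |apply (tree_connected Htree)].
    intros b c (b' & Hb) Hbc; destruct (fwd _ _ _ Hb Hbc) as (c' & _ & Hc); eauto. }
  assert (tot2 : forall a', exists a, D (a, a')).
  { intros a; apply (rt_invariant adj (fun a' => exists a, D (a, a')) u');
      [eauto| |apply (tree_connected Htree)].
    intros b c (b' & Hb) Hbc; destruct (bwd _ _ _ Hb Hbc) as (c' & _ & Hc); eauto. }
  destruct (choice_function _ tot1) as (g & Hg), (choice_function _ tot2) as (h & Hh).
  assert (Hcol : forall w, col (g w) = t (col w)) by (intros w; exact (Dok _ (Hg w))).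
  exists g; split; [split; [split|]|split; [eauto|exact Hcol]].
  - exists h; split; intros v; eauto.
  - intros a b; split; intros Hab.
    + destruct (fwd _ _ _ (Hg a) Hab) as (b' & Hb' & Db).
      now rewrite (uniq1 _ _ _ (Hg b) Db).
    + destruct (bwd _ _ _ (Hg a) Hab) as (b' & Hb' & Db).
      now rewrite (uniq2 _ _ _ (Hg b) Db).
  - intros v; exists t; auto.
Qed.

Lemma local_group_adj g u v : G g -> adj u v -> adj (g u) (g v).
Proof. intros [[_ Hg] _]; apply Hg. Qed.

Lemma half_image g u v a : G g -> half u v a -> half (g u) (g v) (g a).
Proof. intros [Hg _]; now apply half_aut. Qed.

Lemma half_preimage g u v a : G g -> half (g u) (g v) (g a) -> half u v a.
Proof. intros [Hg _]; now apply half_aut. Qed.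

(** Each [g i] fixes both ends of its base edge and so preserves its half-tree. The pieces and the
    identity elsewhere agree on the base edges, the only edges leaving the half-trees, so
    [local_group_local] applies. *)
Lemma glue {I : Type} (p q : I -> V) (g : I -> V -> V) :
  (forall i, adj (p i) (q i)) -> (forall i, G (g i)) ->
  (forall i, g i (p i) = p i) -> (forall i, g i (q i) = q i) ->
  (forall i j w, half (p i) (q i) w -> half (p j) (q j) w -> i = j) ->
  exists f, G f /\ (forall i w, half (p i) (q i) w -> f w = g i w) /\
    (forall w, (forall i, ~ half (p i) (q i) w) -> f w = w).
Proof.
  intros Hadj HG Hp Hq Hdisj.
  (* Stated for an arbitrary family, so that the same construction applied to the inverses yields
     the inverse of [f]. *)
  assert (Hglue : forall g : I -> V -> V, exists f,
    forall w, (forall i, half (p i) (q i) w -> f w = g i w) /\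
      ((forall i, ~ half (p i) (q i) w) -> f w = w)).
  { clear g HG Hp Hq; intros g.
    apply (choice_function (fun w w' => (forall i, half (p i) (q i) w -> w' = g i w) /\
      ((forall i, ~ half (p i) (q i) w) -> w' = w))).
    intros w; destruct (classic (exists i, half (p i) (q i) w)) as [(i & Hi)|Hno].
    - exists (g i w); split.
      + intros j Hj; now rewrite (Hdisj i j w).
      + intros H; now apply H in Hi.
    - exists w; split; [|reflexivity].
      intros i Hi; exfalso; eauto. }
  destruct (choice_function (fun i h => G h /\ (forall w, h (g i w) = w) /\ (forall w, g i (h w) = w)))
    as (g' & Hg').
  { intros i; now apply local_group_perm_group. }
  destruct (Hglue g) as (f & Hf), (Hglue g') as (f' & Hf'); clear Hglue.
  assert (Hg'p : forall i, g' i (p i) = p i) by (intros i; rewrite <- (Hp i) at 1; apply Hg').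
  assert (Hg'q : forall i, g' i (q i) = q i) by (intros i; rewrite <- (Hq i) at 1; apply Hg').
  assert (Hpres : forall i w, half (p i) (q i) w -> half (p i) (q i) (g i w)).
  { intros i w Hw; apply (half_image _ _ _ _ (HG i)) in Hw; now rewrite Hp, Hq in Hw. }
  assert (Hpres' : forall i w, half (p i) (q i) w -> half (p i) (q i) (g' i w)).
  { intros i w Hw; apply (half_image _ _ _ _ (proj1 (Hg' i))) in Hw; now rewrite Hg'p, Hg'q in Hw. }
  assert (Hfq : forall i, f (q i) = q i).
  { intros i; rewrite (proj1 (Hf (q i)) i); [apply Hq|apply half_base]. }
  (* If [p i] lies in another half-tree, the edge to [q i] leaves that half-tree, so [p i] is its
     root [q j], already known to be fixed. *)
  assert (Hfp : forall i, f (p i) = p i).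
  { intros i; destruct (classic (exists j, half (p j) (q j) (p i))) as [(j & Hj)|Hno].
    - destruct (half_exit Htree (p j) (q j) (p i) (q i)) as [-> _]; auto.
      intros Hj'; assert (i = j) as <- by (apply Hdisj with (q i); [apply half_base|exact Hj']).
      now apply (half_origin Htree) in Hj.
    - apply Hf; intros j Hj; eauto. }
  exists f; split; [|split; [intros i w; apply Hf|intros w; apply Hf]].
  apply (local_group_local f f'); intros v.
  - destruct (classic (exists i, half (p i) (q i) v)) as [(i & Hi)|Hno].
    + rewrite (proj1 (Hf v) i Hi), (proj1 (Hf' _) i); [apply Hg'|auto].
    + rewrite (proj2 (Hf v)), (proj2 (Hf' v)); eauto.
  - destruct (classic (exists i, half (p i) (q i) v)) as [(i & Hi)|Hno].
    + rewrite (proj1 (Hf' v) i Hi), (proj1 (Hf _) i); [apply Hg'|auto].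
    + rewrite (proj2 (Hf' v)), (proj2 (Hf v)); eauto.
  - destruct (classic (exists i, half (p i) (q i) v)) as [(i & Hi)|Hno].
    + exists (g i); split; [apply HG|split; [symmetry; now apply Hf|]].
      intros u Hu; destruct (classic (half (p i) (q i) u)) as [Hiu|Hiu].
      * symmetry; now apply Hf.
      * destruct (half_exit Htree (p i) (q i) v u) as [_ ->]; auto; now rewrite Hp, Hfp.
    + exists (fun w => w); split; [apply (proj1 local_group_perm_group)|split].
      * symmetry; apply Hf; eauto.
      * intros u Hu; destruct (classic (exists i, half (p i) (q i) u)) as [(i & Hi)|Hno'].
        -- destruct (half_exit Htree (p i) (q i) u v) as [-> _]; eauto.
        -- symmetry; apply Hf; eauto.
Qed.

(** * Rigid stabilisers of half-trees *)

Definition rigid (u v : V) (f : V -> V) : Prop :=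
  G f /\ forall w, ~ half u v w -> f w = w.

Lemma rigid_subset u v u' v' f :
  (forall a, half u v a -> half u' v' a) -> rigid u v f -> rigid u' v' f.
Proof. intros Hsub [Hf Hfix]; split; [exact Hf|]; intros w Hw; apply Hfix; auto. Qed.

(** The image [f v] is a neighbour of [u]. Inside the half-tree only [v] is one; outside, [f] fixes
    [f v], and injectivity gives [f v = v]. *)
Lemma rigid_fixes_arc u v f : adj u v -> rigid u v f -> f u = u /\ f v = v.
Proof.
  intros Huv [HG Hfix].
  assert (Hu : f u = u) by now apply Hfix, (half_origin Htree).
  split; [exact Hu|].
  destruct (classic (half u v (f v))) as [H|H].
  - apply (half_root Htree u); auto.
    apply Hsym; rewrite <- Hu at 1; now apply local_group_adj.
  - apply (perm_group_inj G f); [apply local_group_perm_group|exact HG|auto].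
Qed.

Lemma rigid_restriction u v g :
  adj u v -> G g -> g u = u -> g v = v ->
  exists f, rigid u v f /\ forall w, half u v w -> f w = g w.
Proof.
  intros Huv HG Hu Hv.
  destruct (glue (fun _ : unit => u) (fun _ => v) (fun _ => g)) as (f & Hf & Hin & Hout);
    auto; [now intros [] []|].
  exists f; split; [split; auto|]; intros w; exact (Hin tt w).
Qed.

Lemma iter_cancel (h h' : V -> V) n x :
  (forall v, h' (h v) = v) -> Nat.iter n h' (Nat.iter n h x) = x.
Proof.
  intros H; induction n as [|n IH]; [reflexivity|].
  rewrite Nat.iter_succ_r; simpl; now rewrite H.
Qed.

(* If the translates [h^n T] of the half-tree [T] are pairwise disjoint, the product [F] of
   the conjugates [h^n f h^-n] for [n >= 0] exists, and [f] is the commutator [[F, h]]. *)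
Lemma rigid_in_normal_of_translates K h u v f :
  normal_subgroup K G -> K h -> adj u v ->
  (forall n w, half u v w ->
     ~ half (Nat.iter (S n) h u) (Nat.iter (S n) h v) w) ->
  rigid u v f -> K f.
Proof.
  intros (HK & HKG & Hconj) Kh Huv Htrans Hf.
  pose proof local_group_perm_group as HG.
  destruct HK as (_ & Kcomp & Kinv), (Kinv h Kh) as (h' & Kh' & Hh'h & Hhh').
  pose proof (fun n => perm_group_iter G h n HG (HKG h Kh)) as Gi.
  pose proof (fun n => perm_group_iter G h' n HG (HKG h' Kh')) as Gi'.
  destruct (rigid_fixes_arc _ _ _ Huv Hf) as [Hfu Hfv].
  destruct Hf as [Gf Hfix].
  assert (half_iter : forall n w, half (Nat.iter n h u) (Nat.iter n h v) (Nat.iter n h w)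
    <-> half u v w)
    by (intros n w; split; [apply (half_preimage _ _ _ _ (Gi n))|apply (half_image _ _ _ _ (Gi n))]).
  assert (Hlt : forall i d w, half (Nat.iter i h u) (Nat.iter i h v) w ->
    half (Nat.iter (i + S d) h u) (Nat.iter (i + S d) h v) w -> False).
  { intros i d w Hi Hj.
    rewrite <- (iter_cancel h' h i w Hhh') in Hi, Hj.
    rewrite !Nat.iter_add in Hj.
    apply half_iter in Hi.
    apply (half_preimage _ _ _ _ (Gi i)) in Hj.
    revert Hj; now apply Htrans. }
  destruct (glue (fun n => Nat.iter n h u) (fun n => Nat.iter n h v)
    (fun n w => Nat.iter n h (f (Nat.iter n h' w)))) as (F & GF & HF & HFout).
  - intros n; now apply (local_group_adj (fun a => Nat.iter n h a)).
  - intros n; apply HG; [apply Gi|]; now apply HG.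
  - intros n; now rewrite iter_cancel, Hfu.
  - intros n; now rewrite iter_cancel, Hfv.
  - intros i j w Hi Hj.
    destruct (Nat.lt_trichotomy i j) as [H|[H|H]]; [exfalso|exact H|exfalso].
    + apply (Hlt i (j - S i) w Hi); now replace (i + S (j - S i)) with j by lia.
    + apply (Hlt j (i - S j) w Hj); now replace (j + S (i - S j)) with i by lia.
  (* On the translate number [n], [F] commutes with [h] and the value lies in translate [n + 1],
     where [f] is trivial. Off all translates [F] is trivial, but [h w] may still lie in translate
     0, where [F] is [f]. *)
  - assert (Hcomm : forall w, f (h (F w)) = F (h w)).
    { intros w.
      destruct (classic (exists n, half (Nat.iter n h u) (Nat.iter n h v) w))
        as [(n & Hn)|Hno].
      - assert (Hn' : half (Nat.iter (S n) h u) (Nat.iter (S n) h v) (h w)).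
        { apply (half_image h); [apply HKG, Kh|exact Hn]. }
        assert (E : F (h w) = h (F w)).
        { now rewrite (HF (S n) _ Hn'), (HF n _ Hn), (Nat.iter_succ_r n V h' (h w)), Hh'h. }
        rewrite E; apply Hfix; intros H.
        apply (Hlt 0 n (h (F w)) H).
        rewrite <- E, (HF (S n) _ Hn').
        apply half_iter.
        rewrite <- Hfu, <- Hfv; apply (half_image f); [exact Gf|].
        apply half_iter with (S n).
        now rewrite (iter_cancel h' h).
      - rewrite (HFout w) by eauto.
        destruct (classic (half u v (h w))) as [H|H].
        + now rewrite (HF 0 (h w) H).
        + rewrite HFout, Hfix; auto.
          intros [|n] Hn; [contradiction|].
          apply Hno; exists n; apply (half_preimage h); [apply HKG, Kh|exact Hn]. }
    destruct HG as (_ & _ & Ginv), (Ginv F GF) as (F' & GF' & HF'F & HFF').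
    replace f with (fun x => F (h (F' (h' x)))).
    + apply (Kcomp (fun x => F (h (F' x))) h' (Hconj F F' h GF HF'F HFF' Kh) Kh').
    + apply functional_extensionality; intros x.
      now rewrite <- Hcomm, HFF', Hhh'.
Qed.

(** * Elements that translate a half-tree into itself *)

(** For [h] in [G] the condition [h p <> p] makes the inclusion strict, so that [h] acts as a
    translation. *)
Definition nested (h : V -> V) (p q : V) : Prop :=
  adj p q /\ h p <> p /\ forall a, half (h p) (h q) a -> half p q a.

(** Complementation reverses the inclusion of half-trees. The new base arc starts at [h q] instead
    of [p], so the kind of its origin can be chosen. *)
Lemma nested_inverse h h' p q :
  G h -> (forall v, h' (h v) = v) -> nested h p q -> nested h' (h q) (h p).
Proof.
  intros Gh Hh'h (Hpq & Hp & Hsub).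
  pose proof (local_group_adj h p q Gh Hpq) as Hpq'.
  split; [auto|split].
  - rewrite Hh'h; intros E.
    rewrite <- E in Hsub, Hpq'.
    apply (half_disjoint Htree q p (h p) p); auto using half_base.
    apply half_opposite; auto.
    intros H; apply Hsub in H; revert H; now apply half_origin.
  - rewrite !Hh'h; intros a Ha.
    apply half_opposite; auto.
    intros H; apply Hsub in H; revert H; now apply half_opposite.
Qed.

(** The half-tree [half u v] lies in [half p q] but outside its image under [h], while all its later
    translates lie inside that image. *)
Lemma rigid_in_normal_of_nested K h p q u v f :
  normal_subgroup K G -> K h -> nested h p q -> adj u v ->
  (forall a, half u v a -> half p q a) ->
  (forall a, half u v a -> ~ half (h p) (h q) a) ->
  rigid u v f -> K f.
Proof.
  intros HK Kh (Hpq & _ & Hnest) Huv Hsub Hout.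
  assert (Gh : G h) by now apply HK.
  apply rigid_in_normal_of_translates with h; auto.
  intros n w Hw Hw'; apply (Hout w Hw).
  assert (Hpq_n : half (Nat.iter (S n) h p) (Nat.iter (S n) h q) w).
  { pose proof (perm_group_iter G h (S n) local_group_perm_group Gh) as Gi.
    destruct local_group_perm_group as (_ & _ & Ginv), (Ginv _ Gi) as (i' & _ & _ & Hi').
    rewrite <- (Hi' w) in Hw' |- *.
    apply (half_image (fun a => Nat.iter (S n) h a)); [exact Gi|].
    apply Hsub; revert Hw'; apply (half_preimage (fun a => Nat.iter (S n) h a)); exact Gi. }
  clear Hw Hw'; revert w Hpq_n; induction n as [|n IH]; intros w Hw; [exact Hw|].
  apply IH.
  destruct local_group_perm_group as (_ & _ & Ginv), (Ginv _ Gh) as (h' & _ & _ & Hhh').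
  pose proof (perm_group_iter G h (S n) local_group_perm_group Gh) as Gi.
  destruct (Ginv _ Gi) as (i' & _ & _ & Hi').
  assert (Hsucc : forall x, Nat.iter (S (S n)) h x = Nat.iter (S n) h (h x))
    by (intros x; apply Nat.iter_succ_r).
  rewrite !Hsucc, <- (Hi' w) in Hw; rewrite <- (Hi' w).
  apply (half_image (fun a => Nat.iter (S n) h a)); [exact Gi|].
  apply Hnest; revert Hw; apply (half_preimage (fun a => Nat.iter (S n) h a)); exact Gi.
Qed.

Lemma mix_colour_permutations c d s t :
  kind c <> kind d -> L s -> L t ->
  exists r, L r /\ (forall a, kind a = kind c -> r a = s a) /\ (forall a, kind a = kind d -> r a = t a).
Proof.
  intros Hk Ls Lt.
  destruct (kind c), (kind d); try (now destruct Hk).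
  - exists (fun a => if kind a then s a else t a).
    split; [now apply (ct_L_mix HT)|split; now intros a ->].
  - exists (fun a => if kind a then t a else s a).
    split; [now apply (ct_L_mix HT)|split; now intros a ->].
Qed.

(** The ends of an arc have colours of opposite kinds, so [s] and [t] merge into one element of [L].
    Once [z] is sent to [z'], the colour determines the image of [w]. *)
Lemma move_arc z w z' w' s t :
  adj z w -> adj z' w' -> L s -> L t -> s (col z) = col z' -> t (col w) = col w' ->
  exists g, G g /\ g z = z' /\ g w = w'.
Proof.
  intros Hzw Hzw' Ls Lt Es Et.
  destruct (mix_colour_permutations (col z) (col w) s t) as (r & Lr & Erz & Erw); auto.
  { now apply (ct_kind HT). }
  destruct (extend_colour_permutation r z z') as (g & Gg & Ez & Hg);
    [exact Lr|rewrite Erz; auto|].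
  exists g; split; [exact Gg|split; [exact Ez|]].
  apply (ct_col_inj HT z'); [rewrite <- Ez; now apply local_group_adj|assumption|].
  rewrite Hg, Erw; auto.
Qed.

Lemma normal_rigid_conj K g q s :
  normal_subgroup K G -> G g -> (forall f, rigid q s f -> K f) ->
  forall f, rigid (g q) (g s) f -> K f.
Proof.
  intros (_ & _ & Hconj) Gg HR f [Gf Hf].
  destruct local_group_perm_group as (_ & Gcomp & Ginv), (Ginv g Gg) as (g' & Gg' & Hg'g & Hgg').
  replace f with (fun x => g (g' (f (g (g' x))))).
  - apply (Hconj g g' (fun x => g' (f (g x)))); auto.
    apply HR; split.
    + apply Gcomp; [assumption|now apply Gcomp].
    + intros w Hw; rewrite Hf, Hg'g; [reflexivity|].
      intros H; apply Hw; revert H; now apply half_preimage.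
  - apply functional_extensionality; intros x; now rewrite !Hgg'.
Qed.

(** * Normal subgroups when [L] is transitive on the colours of one kind *)

Section Transitive_on_one_kind.

Context (k : bool).
Hypothesis Htrans : forall c d, kind c = k -> kind d = k -> exists t, L t /\ t c = d.
Hypothesis Hgen : forall j t, L t -> generated (fun s => L s /\ exists c, kind c = j /\ s c = c) t.

Let L_id : L (fun c => c).
Proof. apply (ct_group HT). Qed.

(* Some translate of the half-tree at [(z, w)] contains its complement properly. *)
Lemma opposite_arc z w :
  adj z w -> exists g, G g /\ (forall a, half (g w) (g z) a -> half z w a) /\
    ~ half (g w) (g z) w.
Proof.
  intros Hzw; pose proof (kind_neighbour _ _ Hzw) as Hk.
  destruct (other_neighbour w z) as (z2 & Hz2 & Hne2).
  pose proof (kind_neighbour _ _ Hz2) as Hk2.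
  destruct (Bool.bool_dec (kind (col z)) k) as [Ez|Ez].
  - destruct (Htrans (col z) (col z2)) as (t & Lt & Et); [exact Ez| |].
    { rewrite <- Ez, Hk, Hk2; now rewrite negb_involutive. }
    destruct (move_arc z w z2 w t (fun c => c)) as (g & Gg & Egz & Egw); auto.
    exists g; rewrite Egz, Egw; split; [exact Gg|split].
    + now apply half_subset_next.
    + now apply half_origin.
  (* Otherwise [w] has kind [k]. The arc is moved along a path [z], [w], [z2], [w2], [z3], with [w]
     going to [w2] and [z] to a vertex [z3] of its own colour. *)
  - destruct (other_neighbour z2 w) as (w2 & Hw2 & Hnew).
    pose proof (kind_neighbour _ _ Hw2) as Hkw.
    destruct (ct_col_surj HT w2 (col z)) as (z3 & Hz3 & Ez3).
    { rewrite Hk, Hk2, Hkw, negb_involutive; intros E; now apply no_fixpoint_negb in E. }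
    destruct (Htrans (col w) (col w2)) as (t & Lt & Et).
    { rewrite Hk in Ez; now destruct (kind (col w)), k. }
    { now destruct (kind (col z)), (kind (col w)), (kind (col z2)), (kind (col w2)), k. }
    destruct (move_arc z w z3 w2 (fun c => c) t) as (g & Gg & Egz & Egw); auto.
    assert (z3 <> z2).
    { intros ->; apply Hne2; apply (ct_col_inj HT w); auto. }
    exists g; rewrite Egz, Egw; split; [exact Gg|].
    assert (Hsub : forall a, half w2 z3 a -> half w z2 a).
    { intros a Ha; apply (half_subset_next Htree w z2 w2); auto.
      revert a Ha; now apply half_subset_next. }
    split.
    + intros a Ha; apply (half_subset_next Htree z w z2); auto.
    + intros Ha; apply Hsub in Ha; revert Ha; now apply half_origin.
Qed.

(** Let [z] be the neighbour of [w] towards [h w], and [T] the half-tree [half z w]. Both ends of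
    the image edge lie outside [T], so [h T] either contains [T], and the inverse of [h] is nested,
    or is disjoint from [T]. *)
Lemma normal_nested K h w :
  normal_subgroup K G -> K h -> h w <> w -> exists h1 p q, K h1 /\ nested h1 p q.
Proof.
  intros ((_ & Kcomp & Kinv) & HKG & Hconj) Kh Hw.
  assert (Gh : G h) by auto.
  destruct (half_towards Htree w (h w)) as (z & Hwz & Hhw); [congruence|].
  assert (Hzw : adj z w) by auto.
  pose proof (local_group_adj h z w Gh Hzw) as Hhzw.
  assert (Hhw' : ~ half z w (h w)) by now apply half_opposite.
  (* Otherwise [h] would invert the edge, contrary to preservation of kinds. *)
  assert (Hhz : ~ half z w (h z)).
  { intros Hz; destruct (half_exit Htree z w (h z) (h w)) as [Ez _]; auto.
    apply (ct_kind HT _ _ Hzw); rewrite <- Ez; symmetry; now apply local_group_kind. }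
  destruct (Kinv h Kh) as (h' & Kh' & Hh'h & Hhh').
  destruct (classic (half (h z) (h w) w)) as [Hin|Hout].
  - assert (Hsub : forall a, half z w a -> half (h z) (h w) a) by now apply half_subset.
    exists h', z, w; repeat split; [exact Kh'|exact Hzw| |].
    + intros E; assert (Ez : h z = z) by now rewrite <- E at 1.
      rewrite Ez in Hhzw, Hin; revert Hin.
      apply (half_disjoint Htree z w (h w)); auto using half_base.
    + intros a Ha; apply (half_preimage h _ _ _ Gh); apply Hsub.
      apply (half_preimage h'); [auto|now rewrite Hh'h].
  - assert (Hsub : forall a, half z w a -> ~ half (h z) (h w) a).
    { intros a Ha; apply half_opposite; auto; revert a Ha.
      apply half_subset; [exact Hhw'|now apply half_opposite]. }
    assert (Hsub' : forall a, half z w a -> ~ half z w (h a)).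
    { intros a Ha H; apply (Hsub _ H); now apply half_image. }
    destruct (opposite_arc z w Hzw) as (g & Gg & Hg & Hgw).
    pose proof (local_group_adj g z w Gg Hzw) as Hgzw.
    destruct local_group_perm_group as (_ & _ & Ginv), (Ginv g Gg) as (g' & Gg' & Hg'g & Hgg').
    (* Here [g] carries the complement of [T] into [T]. As [h] moves [T] off itself, [h a] avoids
       that image, so [g' (h a)] is back in [T]; applying [h] and then [g] lands in the image, a
       proper part of [T]. *)
    set (h1 := fun x => g (h (g' (h x)))).
    assert (Kh1 : K h1) by exact (Kcomp _ h (Hconj g g' h Gg Hg'g Hgg' Kh) Kh).
    assert (Hh1 : forall a, half z w a -> half (g w) (g z) (h1 a)).
    { intros a Ha; unfold h1.
      apply half_image, half_opposite; auto; apply Hsub'.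
      apply (half_preimage g _ _ _ Gg); rewrite Hgg'.
      apply half_opposite; auto; intros H; apply Hg in H; now apply (Hsub' a). }
    assert (Hnest : forall a, half (h1 z) (h1 w) a -> half (g w) (g z) a).
    { intros a Ha; destruct (Ginv h1 (HKG _ Kh1)) as (h1' & _ & _ & Hh1').
      rewrite <- (Hh1' a) in Ha |- *; apply Hh1; revert Ha; apply half_preimage; auto. }
    exists h1, z, w; repeat split; [exact Kh1|exact Hzw| |auto].
    intros E; apply Hgw.
    pose proof (local_group_adj h1 z w (HKG _ Kh1) Hzw) as Hh1zw; rewrite E in Hh1zw.
    rewrite <- (half_root Htree z w (h1 w)) at 2; auto using half_base.
Qed.

(** If [c] and [d] were the only colours of kind [k], a permutation fixing either would fix [c]. The
    generators would then all fix [c], against transitivity. *)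
Lemma third_colour c d :
  kind c = k -> exists e, kind e = k /\ e <> c /\ e <> d.
Proof.
  intros Hc; apply NNPP; intros Hno.
  assert (Hall : forall e, kind e = k -> e = c \/ e = d).
  { intros e He; apply NNPP; intros H; apply Hno; exists e; tauto. }
  assert (Hfix : forall t, L t -> t c = c).
  { intros t Lt; apply (Hgen k t Lt (fun s => L s /\ s c = c)).
    - destruct (ct_group HT) as (Lid & Lcomp & Linv); split; [|split].
      + auto.
      + intros g h [Lg Eg] [Lh Eh]; split; [now apply Lcomp|congruence].
      + intros g [Lg Eg]; destruct (Linv g Lg) as (h & Lh & Hhg & Hgh).
        exists h; repeat split; auto; congruence.
    - intros s (Ls & e & He & Es); split; [exact Ls|].
      destruct (Hall e He) as [->| ->]; [exact Es|].
      destruct (Hall (s c)) as [E|E]; [now rewrite (ct_L_kind HT)|exact E|].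
      rewrite E; apply (perm_group_inj L s); [apply (ct_group HT)|exact Ls|congruence]. }
  destruct (ct_two HT k) as (e & e' & Hne & He & He').
  apply Hne; transitivity c.
  - destruct (Htrans c e) as (t & Lt & <-); auto.
  - destruct (Htrans c e') as (t & Lt & <-); auto; symmetry; auto.
Qed.

(** There are two branches at [q] besides the one through [p], and [x] lies in at most one of
    them. *)
Lemma branch_avoiding q p x :
  adj q p -> kind (col p) = k -> exists s, adj q s /\ s <> p /\ ~ half q s x.
Proof.
  intros Hqp Hp.
  destruct (third_colour (col p) (col p) Hp) as (c1 & Hc1 & Hc1p & _).
  destruct (third_colour (col p) c1 Hp) as (c2 & Hc2 & Hc2p & Hc21).
  assert (Hq : kind (col q) <> k) by (rewrite <- Hp; now apply (ct_kind HT)).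
  destruct (ct_col_surj HT q c1) as (s1 & Hs1 & E1); [congruence|].
  destruct (ct_col_surj HT q c2) as (s2 & Hs2 & E2); [congruence|].
  destruct (classic (half q s1 x)) as [H|H].
  - exists s2; repeat split; [assumption|congruence|].
    apply (half_disjoint Htree q s1 s2); auto; congruence.
  - exists s1; repeat split; [assumption|congruence|assumption].
Qed.

Lemma normal_contains_some_rigid K h w :
  normal_subgroup K G -> K h -> h w <> w ->
  exists q s, adj q s /\ kind (col s) = k /\ forall f, rigid q s f -> K f.
Proof.
  intros HK Kh0 Hw0.
  assert (Hstart : exists h p q, K h /\ nested h p q /\ kind (col p) = k).
  { destruct (normal_nested K h w HK Kh0 Hw0) as (h1 & p & q & Kh1 & Hn).
    destruct (Bool.bool_dec (kind (col p)) k) as [E|E]; [exists h1, p, q; auto|].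
    destruct HK as ((_ & _ & Kinv) & HKG & _), (Kinv h1 Kh1) as (h' & Kh' & Hh'h & _).
    exists h', (h1 q), (h1 p); split; [exact Kh'|split].
    - apply nested_inverse; auto.
    - rewrite local_group_kind by auto.
      rewrite (kind_neighbour p q) in E by apply Hn; now destruct (kind (col q)), k. }
  clear h w Kh0 Hw0; destruct Hstart as (h & p & q & Kh & Hn & Hp).
  assert (Gh : G h) by now apply HK.
  destruct Hn as (Hpq & Hhp & Hnest).
  pose proof (local_group_adj h p q Gh Hpq) as Hhpq.
  (* The branch at [q] avoids both [p] and [h q], so it hangs off the axis of [h]. *)
  destruct (branch_avoiding q p (h q)) as (s & Hqs & Hsp & Hs); auto.
  exists q, s; split; [exact Hqs|split].
  { rewrite <- Hp; rewrite (kind_neighbour p q), (kind_neighbour s q); auto. }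
  intros f Hf; apply (rigid_in_normal_of_nested K h p q q s f HK Kh); auto.
  - repeat split; auto.
  - now apply half_subset_next.
  - intros a Ha; apply half_opposite; auto; revert a Ha.
    apply half_subset; [exact Hs|].
    (* If [s] were beyond the edge from [h p] to [h q], then either [q] is too and its edge to [p]
       leaves, forcing [h p = p], or the edge from [s] to [q] leaves, forcing [s = h q]. *)
    apply half_opposite; auto; intros Hs'.
    destruct (half_exit Htree (h p) (h q) s q) as [-> _]; auto.
    + intros Hq; destruct (half_exit Htree (h p) (h q) q p) as [_ E]; auto.
      intros H; apply Hnest in H; revert H; now apply half_origin.
    + apply Hs, half_base.
Qed.

Lemma normal_contains_rigid K h w :
  normal_subgroup K G -> K h -> h w <> w ->
  forall u v, adj u v -> forall f, rigid u v f -> K f.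
Proof.
  intros HK Kh Hw.
  destruct (normal_contains_some_rigid K h w HK Kh Hw) as (q & s & Hqs & Hs & HR).
  assert (Hmove : forall q s q' s', adj q s -> adj q' s' -> kind (col s) = k ->
    col q' = col q -> (forall f, rigid q s f -> K f) -> forall f, rigid q' s' f -> K f).
  { clear q s Hqs Hs HR; intros q s q' s' Hqs Hqs' Hs Eq HR.
    destruct (Htrans (col s) (col s')) as (t & Lt & Et); [exact Hs| |].
    { rewrite (kind_neighbour s' q'), Eq, <- (kind_neighbour s q); auto. }
    destruct (move_arc q s q' s' (fun c => c) t) as (g & Gg & <- & <-); auto.
    now apply normal_rigid_conj. }
  assert (Hk : forall u v, adj u v -> kind (col v) = k -> forall f, rigid u v f -> K f).
  { intros u v Huv Hv.
    destruct (classic (col u = col q)) as [E|E]; [now apply (Hmove q s u v)|].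
    (* Transitivity does not change the colour of the origin, so an arc from a vertex [q1] of the
       required colour is first found inside [half q s]; smaller half-trees have smaller rigid
       stabilisers. *)
    destruct (ct_col_surj HT s (col u)) as (q1 & Hq1 & E1).
    { rewrite Hs, <- Hv; now apply (ct_kind HT). }
    destruct (other_neighbour q1 s) as (s1 & Hs1 & Hne).
    apply (Hmove q1 s1 u v); auto.
    - rewrite (kind_neighbour s1 q1), <- (kind_neighbour s q1); auto.
    - intros f Hf; apply HR; revert Hf; apply rigid_subset; intros a Ha.
      apply (half_subset_next Htree q s q1); auto; [congruence|].
      now apply (half_subset_next Htree s q1 s1). }
  intros u v Huv f Hf.
  destruct (Bool.bool_dec (kind (col v)) k) as [Hv|Hv]; [now apply (Hk u v)|].
  destruct (other_neighbour u v) as (q1 & Hq1 & Hne).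
  apply (Hk q1 u); auto.
  - rewrite (kind_neighbour u v) by exact Huv; now destruct (kind (col v)), k.
  - revert Hf; apply rigid_subset; intros a Ha.
    apply (half_subset_next Htree q1 u v); auto.
Qed.

(** * Generation by rigid stabilisers *)

Section Generation_by_rigid_elements.

Context (K : (V -> V) -> Prop).
Hypothesis HK : perm_group K.
Hypothesis HKG : forall g, K g -> G g.
Hypothesis HKR : forall u v, adj u v -> forall f, rigid u v f -> K f.

(** By generation [t] may be assumed to fix the colour of some neighbour [v] of [u]. An extension
    fixing [u] and [v] is cut down to [half v u], which contains all other neighbours of [u], so its
    local action at [u] survives. *)
Lemma realise_local_action u t :
  L t -> exists g, K g /\ g u = u /\ forall v, adj u v -> col (g v) = t (col v).
Proof.
  intros Lt; destruct HK as (Kid & Kcomp & Kinv).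
  destruct (ct_group HT) as (_ & Lcomp & Linv).
  apply (Hgen (negb (kind (col u))) t Lt (fun t => L t /\ exists g, K g /\ g u = u /\
    forall v, adj u v -> col (g v) = t (col v))); [split; [|split]|].
  - split; [exact L_id|exists (fun v => v); auto].
  - intros s r [Ls (g & Kg & Eg & Hg)] [Lr (h & Kh & Eh & Hh)]; split; [now apply Lcomp|].
    exists (fun v => g (h v)); repeat split; [now apply Kcomp|congruence|].
    intros v Hv; rewrite <- Hh, Hg; auto.
    rewrite <- Eh; apply local_group_adj; auto.
  - intros s [Ls (g & Kg & Eg & Hg)]; destruct (Linv s Ls) as (r & Lr & Hrs & Hsr).
    exists r; repeat split; auto.
    destruct (Kinv g Kg) as (h & Kh & Hhg & Hgh).
    assert (Eh : h u = u) by congruence.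
    exists h; repeat split; auto.
    intros v Hv; rewrite <- (Hgh v) at 2; rewrite Hg, Hrs; [reflexivity|].
    rewrite <- Eh; apply local_group_adj; auto.
  - intros s (Ls & c & Hc & Es); split; [exact Ls|].
    destruct (mix_colour_permutations c (col u) s (fun c => c)) as (r & Lr & Er & Eu); auto.
    { rewrite Hc; apply no_fixpoint_negb. }
    destruct (extend_colour_permutation r u u) as (g & Gg & Egu & Hg); [assumption|symmetry; auto|].
    destruct (ct_col_surj HT u c) as (v & Huv & Ev).
    { rewrite Hc; apply no_fixpoint_negb. }
    assert (Egv : g v = v).
    { apply (ct_col_inj HT u); [rewrite <- Egu; now apply local_group_adj|exact Huv|].
      rewrite Hg, Ev, Er; auto. }
    destruct (rigid_restriction v u g) as (f & Hf & Hfg); auto.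
    destruct (rigid_fixes_arc v u f) as [Efv Efu]; auto.
    exists f; split; [now apply (HKR v u); auto|split; [exact Efu|]].
    intros w Huw; destruct (classic (w = v)) as [->|Hne]; [now rewrite Efv, Ev, Es|].
    rewrite Hfg; [rewrite Hg; apply Er; rewrite Hc; apply kind_neighbour; auto|].
    apply half_step with u; auto using half_base.
Qed.

Lemma same_kind_orbit v w : kind (col v) = k -> kind (col w) = k -> exists g, K g /\ g v = w.
Proof.
  intros Hv; destruct HK as (Kid & Kcomp & _).
  (* At vertices of the other kind the invariant says that all neighbours lie in the orbit; these
     are permuted transitively by local actions realised in [K]. *)
  enough (H : (kind (col w) = k -> exists g, K g /\ g v = w) /\
    (kind (col w) <> k -> forall x, adj w x -> exists g, K g /\ g v = x)) by apply H.
  apply (rt_invariant adj (fun w => (kind (col w) = k -> exists g, K g /\ g v = w) /\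
    (kind (col w) <> k -> forall x, adj w x -> exists g, K g /\ g v = x)) v);
    [| |apply (tree_connected Htree)].
  - split; [exists (fun x => x); auto|contradiction].
  - clear w; intros w x [H1 H2] Hwx.
    pose proof (ct_kind HT _ _ Hwx) as Hk.
    split; intros Hx; [apply H2; congruence|].
    assert (Hw : kind (col w) = k)
      by (rewrite (kind_neighbour w x Hwx); now destruct (kind (col x)), k).
    intros y Hxy; destruct (H1 Hw) as (g & Kg & Eg).
    destruct (Htrans (col w) (col y)) as (t & Lt & Et); [exact Hw| |].
    { rewrite (kind_neighbour y x), <- (kind_neighbour w x); auto. }
    destruct (realise_local_action x t Lt) as (h & Kh & Ehx & Hh).
    exists (fun a => h (g a)); split; [now apply Kcomp|]; rewrite Eg.
    apply (ct_col_inj HT x); [rewrite <- Ehx at 1; apply local_group_adj; auto|exact Hxy|].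
    rewrite Hh; auto.
Qed.

(** Multiplication by [k1] makes [g] fix [v], and by [k2] makes its local action at [v] trivial. The
    result fixes an edge, hence is the product of its restrictions to the two half-trees there. *)
Lemma generated_by_rigid g : G g -> K g.
Proof.
  intros Gg.
  pose proof local_group_perm_group as (_ & Gcomp & _).
  destruct HK as (_ & Kcomp & Kinv).
  assert (Hcancel : forall f g, K f -> K (fun x => f (g x)) -> K g).
  { intros f f1 Kf Kff; destruct (Kinv f Kf) as (f' & Kf' & Hf'f & _).
    replace f1 with (fun x => f' (f (f1 x))) by (apply functional_extensionality; auto).
    exact (Kcomp f' _ Kf' Kff). }
  assert (Hv : exists v, kind (col v) = k).
  { destruct (proj1 Htree) as [v], (neighbour v) as (u & Huv).
    destruct (Bool.bool_dec (kind (col v)) k) as [E|E]; [now exists v|exists u].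
    rewrite (kind_neighbour u v); auto; now destruct (kind (col v)), k. }
  destruct Hv as (v & Hv).
  destruct (same_kind_orbit (g v) v) as (k1 & Kk1 & Ek1);
    [now rewrite local_group_kind|exact Hv|].
  apply (Hcancel k1 g Kk1).
  set (g1 := fun x => k1 (g x)).
  assert (Gg1 : G g1) by exact (Gcomp k1 g (HKG _ Kk1) Gg).
  destruct (proj2 Gg1 v) as (t & Lt & Et).
  destruct (proj2 (proj2 (ct_group HT)) t Lt) as (r & Lr & Hrt & _).
  destruct (realise_local_action v r Lr) as (k2 & Kk2 & Ek2 & Hk2).
  apply (Hcancel k2 g1 Kk2).
  set (g2 := fun x => k2 (g1 x)).
  assert (Gg2 : G g2) by exact (Gcomp k2 g1 (HKG _ Kk2) Gg1).
  assert (Ev : g2 v = v) by (unfold g2, g1; now rewrite Ek1).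
  destruct (neighbour v) as (u & Hvu).
  assert (Eu : g2 u = u).
  { apply (ct_col_inj HT v); [rewrite <- Ev; now apply local_group_adj|exact Hvu|].
    unfold g2; rewrite Hk2, Et, Hrt; auto.
    rewrite <- Ek1; now apply (local_group_adj g1). }
  assert (Huv : adj u v) by auto.
  destruct (rigid_restriction v u g2) as (f1 & Hf1 & E1); auto.
  destruct (rigid_restriction u v g2) as (f2 & Hf2 & E2); auto.
  replace g2 with (fun x => f1 (f2 x)); [apply Kcomp; eauto|].
  apply functional_extensionality; intros x.
  destruct (classic (half v u x)) as [Hx|Hx].
  - rewrite (proj2 Hf2); [auto|now apply half_opposite].
  - assert (Hx' : half u v x) by now apply half_opposite.
    rewrite E2 by exact Hx'; apply Hf1.
    apply half_opposite; auto.
    apply (half_image g2) in Hx'; [now rewrite Eu, Ev in Hx'|exact Gg2].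
Qed.
End Generation_by_rigid_elements.
End Transitive_on_one_kind.

(** * Elliptic elements and the simplicity criterion *)

(** Extending [t] around a neighbour of a vertex coloured [c] gives the element. It shows that [G]
    is nontrivial and, having a fixed vertex, that the winding kernel based there is nontrivial. *)
Lemma nontrivial_elliptic t c :
  L t -> t c <> c -> exists g u v, G g /\ g u = u /\ g v <> v.
Proof.
  intros Lt Hc; destruct (proj1 Htree) as [v0].
  assert (Hv : exists v, col v = c).
  { destruct (neighbour v0) as (v1 & H01), (Bool.bool_dec (kind c) (kind (col v0))) as [E|E].
    - destruct (ct_col_surj HT v1 c) as (v & _ & Ev); [|now exists v].
      rewrite E; now apply (ct_kind HT).
    - destruct (ct_col_surj HT v0 c E) as (v & _ & Ev); now exists v. }
  destruct Hv as (v & <-), (neighbour v) as (u & Hvu).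
  destruct (mix_colour_permutations (col u) (col v) (fun c => c) t) as (r & Lr & Eu & Ev); auto.
  { now apply (ct_kind HT), Hsym. }
  { apply (ct_group HT). }
  destruct (extend_colour_permutation r u u) as (g & Gg & Egu & Hg); [exact Lr|symmetry; auto|].
  exists g, u, v; split; [exact Gg|split; [exact Egu|]].
  intros E; apply Hc; rewrite <- Ev, <- Hg; congruence.
Qed.

Theorem local_group_simple k t c :
  (forall c d, kind c = k -> kind d = k -> exists t, L t /\ t c = d) ->
  (forall j t, L t -> generated (fun s => L s /\ exists c, kind c = j /\ s c = c) t) ->
  L t -> t c <> c -> simple_perm_group G.
Proof.
  intros Htrans Hgen Lt Hc; split; [exact local_group_perm_group|split].
  - destruct (nontrivial_elliptic t c Lt Hc) as (g & _ & v & Gg & _ & Hv).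
    exists g; eauto.
  - intros K HK; destruct (classic (exists h w, K h /\ h w <> w)) as [(h & w & Kh & Hw)|Hno].
    + right; apply (generated_by_rigid k Htrans Hgen K); [apply HK|apply HK|].
      exact (normal_contains_rigid k Htrans Hgen K h w HK Kh Hw).
    + left; intros h Kh w; apply NNPP; intros Hw; apply Hno; eauto.
Qed.

(** * The intransitive case *)

Section Intransitive.

Context (e f : C).

Let orb (c d : C) : Prop := exists t, L t /\ t c = d.

Let crossing (a b : V) : Z :=
  if excluded_middle_informative (orb e (col a) /\ orb f (col b)) then 1%Z else 0%Z.

(* The signed number of crossings from the orbit of [e] to the orbit of [f] is a
   [G]-invariant cocycle on arcs; on the tree it integrates to a homomorphism from [G] to
   the integers killing all vertex stabilisers, whose kernel is [winding_kernel v0]. *)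
Let winding_step (p q : V * Z) : Prop :=
  adj (fst p) (fst q) /\ snd q = (snd p + crossing (fst p) (fst q) - crossing (fst q) (fst p))%Z.

Let winding : V * Z -> V * Z -> Prop := clos_refl_trans winding_step.

Definition winding_kernel (v0 : V) (g : V -> V) : Prop := G g /\ winding (v0, 0%Z) (g v0, 0%Z).

Lemma orb_trans a b c : orb a b -> orb b c -> orb a c.
Proof.
  intros (s & Ls & <-) (t & Lt & <-); exists (fun c => t (s c)); split; [|reflexivity].
  now apply (ct_group HT).
Qed.

Lemma orb_sym a b : orb a b -> orb b a.
Proof.
  intros (s & Ls & <-); destruct (proj2 (proj2 (ct_group HT)) s Ls) as (t & Lt & E & _).
  now exists t.
Qed.

Lemma orb_image g a : G g -> orb (col a) (col (g a)).
Proof.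
  intros [_ Hg]; destruct (neighbour a) as (u & Hu), (Hg u) as (t & Lt & Et).
  exists t; split; [exact Lt|]; rewrite Et; auto.
Qed.

Lemma crossing_image g a b : G g -> crossing (g a) (g b) = crossing a b.
Proof.
  intros Gg; unfold crossing.
  pose proof (orb_image g a Gg) as Ha; pose proof (orb_image g b Gg) as Hb.
  destruct excluded_middle_informative as [[H1 H2]|H],
    excluded_middle_informative as [[H1' H2']|H']; try reflexivity; exfalso.
  - apply H'; split; eapply orb_trans; eauto using orb_sym.
  - apply H; split; eapply orb_trans; eauto.
Qed.

Lemma winding_sym p q : winding p q -> winding q p.
Proof. apply rt_sym; intros a b [Hab E]; split; [auto|lia]. Qed.

Lemma winding_image g p q :
  G g -> winding p q -> winding (g (fst p), snd p) (g (fst q), snd q).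
Proof.
  intros Gg; apply (rt_map winding_step winding_step (fun p => (g (fst p), snd p))).
  intros a b [Hab E]; split; simpl; [now apply local_group_adj|].
  now rewrite !crossing_image.
Qed.

Lemma winding_shift d p q :
  winding p q -> winding (fst p, (snd p + d)%Z) (fst q, (snd q + d)%Z).
Proof.
  apply (rt_map winding_step winding_step (fun p => (fst p, (snd p + d)%Z))).
  intros a b [Hab E]; split; simpl; [exact Hab|lia].
Qed.

(** The increment depends only on the arc and changes sign with its direction, so the steps form a
    covering of the tree and the total is independent of the walk. *)
Lemma winding_unique a m n : winding (a, m) (a, n) -> m = n.
Proof.
  intros H; enough ((a, m) = (a, n)) by congruence.
  apply (cover_injective adj winding_step fst Htree); [now intros p q []| |exact H|reflexivity].
  intros [p i] [q j] [r l] [_ E] [_ E'] Epr; simpl in *; subst; f_equal; lia.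
Qed.

Lemma winding_total a m b : exists n, winding (a, m) (b, n).
Proof.
  apply (rt_invariant adj (fun b => exists n, winding (a, m) (b, n)) a);
    [exists m; apply rt_refl| |apply (tree_connected Htree)].
  intros c d (n & Hn) Hcd; exists (n + crossing c d - crossing d c)%Z.
  apply rt_trans with (c, n); [exact Hn|now apply rt_step].
Qed.

Lemma winding_kernel_normal v0 : normal_subgroup (winding_kernel v0) G.
Proof.
  pose proof local_group_perm_group as (Gid & Gcomp & Ginv).
  split; [split; [|split]|split].
  - split; [exact Gid|apply rt_refl].
  - intros g h [Gg Hg] [Gh Hh]; split; [now apply Gcomp|].
    apply rt_trans with (g v0, 0%Z); [exact Hg|exact (winding_image g _ _ Gg Hh)].
  - intros g [Gg Hg]; destruct (Ginv g Gg) as (h & Gh & Hhg & Hgh).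
    exists h; repeat split; auto; try apply Gh.
    apply winding_sym; apply (winding_image h) in Hg; [|exact Gh].
    simpl in Hg; now rewrite Hhg in Hg.
  - now intros g [Gg _].
  - intros x x' g Gx Hx'x Hxx' [Gg Hg].
    assert (Gx' : G x').
    { destruct (Ginv x Gx) as (y & Gy & Hyx & Hxy).
      replace x' with y; [exact Gy|].
      apply functional_extensionality; intros v; now rewrite <- (Hx'x (y v)), Hxy. }
    split; [exact (Gcomp _ _ Gx (Gcomp _ _ Gg Gx'))|].
    (* The total [n] from [v0] to [x' v0] is invariant under [g], so it cancels: the displacement by
       [g] is zero at [x' v0] as well. *)
    destruct (winding_total v0 0%Z (x' v0)) as (n & Hn).
    assert (H : winding (x' v0, n) (g (x' v0), n)).
    { apply rt_trans with (v0, 0%Z); [now apply winding_sym|].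
      apply rt_trans with (g v0, 0%Z); [exact Hg|exact (winding_image g _ _ Gg Hn)]. }
    apply (winding_image x) in H; [|exact Gx].
    apply (winding_shift (- n)%Z) in H; simpl in H.
    now rewrite Hxx', Z.add_opp_diag_r in H.
Qed.

Lemma orb_kind a b : orb a b -> kind b = kind a.
Proof. intros (t & Lt & <-); now apply (ct_L_kind HT). Qed.

(** Along a path coloured [e], [f], [e'], [f'], [e] only the first edge is counted, since [e'] and
    [f'] avoid the orbits of [e] and [f]. The two ends have equal colours, so the identity colour
    permutation extends to an element with winding number one. *)
Lemma winding_kernel_proper v0 e' f' :
  col v0 = e -> kind e' = kind e -> kind f' = kind f -> kind e <> kind f ->
  ~ orb e e' -> ~ orb f f' -> exists g, G g /\ ~ winding_kernel v0 g.
Proof.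
  intros E0 Ke Kf Kef He Hf.
  destruct (ct_col_surj HT v0 f) as (v1 & H01 & E1); [congruence|].
  destruct (ct_col_surj HT v1 e') as (v2 & H12 & E2); [congruence|].
  destruct (ct_col_surj HT v2 f') as (v3 & H23 & E3); [congruence|].
  destruct (ct_col_surj HT v3 e) as (v4 & H34 & E4); [congruence|].
  destruct (extend_colour_permutation (fun c => c) v0 v4) as (g & Gg & Eg & _);
    [apply (ct_group HT)|congruence|].
  exists g; split; [exact Gg|intros [_ H]; rewrite Eg in H].
  assert (orb_refl : forall c, orb c c) by (intros c; exists (fun c => c); split; [apply (ct_group HT)|auto]).
  assert (Hef : ~ orb e f) by (intros Ho; apply orb_kind in Ho; congruence).
  assert (Hef' : ~ orb e f') by (intros Ho; apply orb_kind in Ho; congruence).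
  assert (Hno : forall a b, ~ (orb e (col a) /\ orb f (col b)) -> crossing a b = 0%Z)
    by (intros a b Hab; unfold crossing; now destruct excluded_middle_informative).
  assert (Hyes : crossing v0 v1 = 1%Z).
  { unfold crossing; destruct excluded_middle_informative as [_|Hn]; [reflexivity|].
    exfalso; apply Hn; rewrite E0, E1; auto. }
  assert (Hw : winding (v0, 0%Z) (v4, 1%Z)).
  { apply rt_trans with (v1, 1%Z); [|apply rt_trans with (v2, 1%Z); [|apply rt_trans with (v3, 1%Z)]];
      apply rt_step; split; auto; cbn [fst snd].
    - rewrite Hyes, (Hno v1 v0); [reflexivity|rewrite E1; tauto].
    - rewrite (Hno v1 v2), (Hno v2 v1); [reflexivity|rewrite E2; tauto|rewrite E1; tauto].
    - rewrite (Hno v2 v3), (Hno v3 v2); [reflexivity|rewrite E3; tauto|rewrite E2; tauto].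
    - rewrite (Hno v3 v4), (Hno v4 v3); [reflexivity|rewrite E3; tauto|rewrite E3; tauto]. }
  assert (0 = 1)%Z; [|lia].
  apply (winding_unique v4); apply rt_trans with (v0, 0%Z); [now apply winding_sym|exact Hw].
Qed.

End Intransitive.

Lemma local_group_not_simple t c :
  (forall k, exists c d, kind c = k /\ kind d = k /\ forall t, L t -> t c <> d) ->
  L t -> t c <> c -> ~ simple_perm_group G.
Proof.
  intros Hintr Lt Hc (_ & _ & Hsimple).
  assert (Horb : forall e, exists e', kind e' = kind e /\ ~ exists t, L t /\ t e = e').
  { intros e; apply NNPP; intros Hno.
    destruct (Hintr (kind e)) as (a & b & Ha & Hb & Hab).
    assert (H : forall d, kind d = kind e -> exists t, L t /\ t e = d).
    { intros d Hd; apply NNPP; intros H; apply Hno; eauto. }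
    destruct (orb_trans a e b) as (r & Lr & Er); [apply orb_sym; auto|auto|].
    now apply (Hab r). }
  destruct (nontrivial_elliptic t c Lt Hc) as (h & v0 & w & Gh & Ev0 & Hw).
  destruct (ct_two HT (negb (kind (col v0)))) as (f & _ & _ & Kf & _).
  destruct (Horb (col v0)) as (e' & Ke' & He'), (Horb f) as (f' & Kf' & Hf').
  destruct (winding_kernel_proper (col v0) f v0 e' f') as (g & Gg & Hg); auto.
  { rewrite Kf; apply not_eq_sym, no_fixpoint_negb. }
  destruct (Hsimple _ (winding_kernel_normal (col v0) f v0)) as [H|H]; [|auto].
  apply Hw, H; split; [exact Gh|rewrite Ev0; apply rt_refl].
Qed.

End Coloured_trees.

(** * Transport of simplicity *)

(** The relation [R] is the graph of a group isomorphism; being a relation, it can be flipped to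
    transport simplicity in either direction. *)
Lemma simple_perm_group_transfer {A B : Type} (G : (A -> A) -> Prop) (H : (B -> B) -> Prop)
    (R : (A -> A) -> (B -> B) -> Prop) :
  (forall g, G g -> exists h, H h /\ R g h) ->
  (forall h, H h -> exists g, G g /\ R g h) ->
  (forall g g' h, G g -> G g' -> R g h -> R g' h -> g = g') ->
  (forall g h h', H h -> H h' -> R g h -> R g h' -> h = h') ->
  H (fun b => b) -> (forall h h', H h -> H h' -> H (fun b => h (h' b))) ->
  R (fun a => a) (fun b => b) ->
  (forall g g' h h', R g h -> R g' h' -> R (fun a => g (g' a)) (fun b => h (h' b))) ->
  simple_perm_group G -> simple_perm_group H.
Proof.
  intros GH HG inj fct Hid Hcomp Rid Rcomp ((Gid & Gcomp & Ginv) & (g0 & Gg0 & a0 & Ha0) & Hsimple).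
  assert (Rinv : forall g g' h h', H h -> H h' -> R g h -> R g' h' -> (forall a, g (g' a) = a) -> forall b, h (h' b) = b).
  { intros g g' h h' Hh Hh' Rg Rg' E b.
    pose proof (Rcomp _ _ _ _ Rg Rg') as Rgg'.
    replace (fun a => g (g' a)) with (fun a : A => a) in Rgg'
      by (apply functional_extensionality; auto).
    exact (f_equal (fun k => k b) (fct _ _ _ (Hcomp _ _ Hh Hh') Hid Rgg' Rid)). }
  assert (Rinv' : forall g g' h h', G g -> G g' -> R g h -> R g' h' -> (forall b, h (h' b) = b) ->
    forall a, g (g' a) = a).
  { intros g g' h h' Gg Gg' Rg Rg' E a.
    pose proof (Rcomp _ _ _ _ Rg Rg') as Rgg'.
    replace (fun b => h (h' b)) with (fun b : B => b) in Rgg'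
      by (apply functional_extensionality; auto).
    exact (f_equal (fun k => k a) (inj _ _ _ (Gcomp _ _ Gg Gg') Gid Rgg' Rid)). }
  split; [split; [exact Hid|split; [exact Hcomp|]]|split].
  - intros h Hh; destruct (HG h Hh) as (g & Gg & Rg), (Ginv g Gg) as (g' & Gg' & E & E').
    destruct (GH g' Gg') as (h' & Hh' & Rg'); exists h'; repeat split; eauto.
  - destruct (GH g0 Gg0) as (h & Hh & Rh); exists h; split; [exact Hh|].
    apply NNPP; intros Hno; apply Ha0.
    assert (h = fun b => b) as ->
      by (apply functional_extensionality; intros b; apply NNPP; eauto).
    exact (f_equal (fun k => k a0) (inj _ _ _ Gg0 Gid Rh Rid)).
  - intros K ((Kid & Kcomp & Kinv) & KH & Kconj).
    (* The preimage of [K] under the isomorphism. *)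
    destruct (Hsimple (fun g => G g /\ exists h, K h /\ R g h)) as [HK|HK].
    + split; [split; [|split]|split].
      * split; [exact Gid|eauto].
      * intros g g' [Gg (h & Kh & Rg)] [Gg' (h' & Kh' & Rg')]; split; [auto|].
        exists (fun b => h (h' b)); auto.
      * intros g [Gg (h & Kh & Rg)]; destruct (Ginv g Gg) as (g' & Gg' & E & E').
        exists g'; repeat split; auto.
        destruct (Kinv h Kh) as (h' & Kh' & F & F').
        exists h'; split; [exact Kh'|].
        destruct (GH g' Gg') as (h'' & Hh'' & Rg').
        replace h' with h''; [exact Rg'|].
        apply functional_extensionality; intros b.
        rewrite <- (F (h'' b)); now rewrite (Rinv _ _ _ _ (KH h Kh) Hh'' Rg Rg' E').
      * tauto.
      * intros x x' k Gx E E' [Gk (h & Kh & Rk)].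
        destruct (Ginv x Gx) as (y & Gy & F & F').
        assert (x' = y) as ->.
        { apply functional_extensionality; intros a; now rewrite <- (F' a) at 1. }
        split; [exact (Gcomp _ _ Gx (Gcomp _ _ Gk Gy))|].
        destruct (GH x Gx) as (u & Hu & Rx), (GH y Gy) as (u' & Hu' & Ry).
        exists (fun b => u (h (u' b))); split; [|exact (Rcomp _ _ _ _ Rx (Rcomp _ _ _ _ Rk Ry))].
        apply Kconj; eauto.
    + left; intros k Kk b; destruct (HG k (KH k Kk)) as (g & Gg & Rg).
      assert (g = fun a => a) as ->
        by (apply functional_extensionality; apply HK; eauto).
      exact (f_equal (fun k => k b) (fct _ _ _ (KH k Kk) Hid Rg Rid)).
    + right; intros h Hh; destruct (HG h Hh) as (g & Gg & Rg), (HK g Gg) as [_ (h' & Kh' & Rg')].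
      now rewrite (fct _ _ _ Hh (KH h' Kh') Rg Rg').
Qed.

(** * The box product *)

Definition sum_perm {X Y : Type} (m : X -> X) (n : Y -> Y) (c : X + Y) : X + Y :=
  match c with inl x => inl (m x) | inr y => inr (n y) end.

Definition sum_group {X Y : Type} (M : (X -> X) -> Prop) (N : (Y -> Y) -> Prop)
    (t : X + Y -> X + Y) : Prop :=
  exists m n, M m /\ N n /\ t = sum_perm m n.

Definition is_left {X Y : Type} (c : X + Y) : bool := if c then true else false.

(** The elements whose image under the homomorphism [phi] lies in [H] form a subgroup containing the
    point stabilisers. *)
Lemma generated_image {A B : Type} (M : (A -> A) -> Prop) (phi : (A -> A) -> B -> B)
    (H : (B -> B) -> Prop) :
  perm_group M -> perm_group H -> gen_by_point_stabilisers M ->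
  phi (fun a => a) = (fun b => b) ->
  (forall g h, phi (fun a => g (h a)) = fun b => phi g (phi h b)) ->
  (forall a s, stabiliser M a s -> H (phi s)) ->
  forall m, M m -> H (phi m).
Proof.
  intros (Mid & Mcomp & Minv) (Hid & Hcomp & Hinv) HM phi_id phi_comp Hstab m Mm.
  apply (HM m Mm (fun m => M m /\ H (phi m))).
  - split; [rewrite phi_id; auto|split].
    + intros g h [] []; rewrite phi_comp; auto.
    + intros g [Mg Hg]; destruct (Minv g Mg) as (h & Mh & Hhg & Hgh).
      exists h; repeat split; auto.
      destruct (Hinv _ Hg) as (k & Hk & Hkg & _).
      replace (phi h) with k; [exact Hk|].
      apply functional_extensionality; intros b.
      transitivity (k (phi g (phi h b))); [|apply Hkg].
      change (phi g (phi h b)) with ((fun b => phi g (phi h b)) b).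
      rewrite <- phi_comp.
      replace (fun a => g (h a)) with (fun a : A => a)
        by (apply functional_extensionality; auto).
      now rewrite phi_id.
  - intros s (a & Ha); split; [apply Ha|eauto].
Qed.

Section Box_product.

Context {X Y : Type} {M : (X -> X) -> Prop} {N : (Y -> Y) -> Prop}.
Context (HX : at_least_two X) (HY : at_least_two Y) (HM : perm_group M) (HN : perm_group N).

Lemma sum_perm_comp (m m' : X -> X) (n n' : Y -> Y) :
  sum_perm (fun x => m (m' x)) (fun y => n (n' y)) = fun c => sum_perm m n (sum_perm m' n' c).
Proof. apply functional_extensionality; now intros []. Qed.

Lemma sum_perm_id : sum_perm (fun x : X => x) (fun y : Y => y) = fun c => c.
Proof. apply functional_extensionality; now intros []. Qed.

Lemma sum_group_perm_group : perm_group (sum_group M N).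
Proof.
  destruct HM as (Mid & Mcomp & Minv), HN as (Nid & Ncomp & Ninv); split; [|split].
  - rewrite <- sum_perm_id; do 2 eexists; eauto.
  - intros _ _ (m & n & Hm & Hn & ->) (m' & n' & Hm' & Hn' & ->).
    rewrite <- sum_perm_comp; do 2 eexists; eauto.
  - intros _ (m & n & Hm & Hn & ->).
    destruct (Minv m Hm) as (m' & Hm' & Em & Em'), (Ninv n Hn) as (n' & Hn' & En & En').
    exists (sum_perm m' n'); split; [do 2 eexists; eauto|].
    split; intros []; simpl; congruence.
Qed.

(** Split into an [M]-factor and an [N]-factor. The factor acting on the other kind fixes every
    colour of kind [j]; the one acting on kind [j] is generated by images of point stabilisers. *)
Lemma sum_group_generated (j : bool) t :
  gen_by_point_stabilisers M -> gen_by_point_stabilisers N -> sum_group M N t ->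
  generated (fun s => sum_group M N s /\ exists c, is_left c = j /\ s c = c) t.
Proof.
  intros GM GN (m & n & Hm & Hn & ->) H HH Hstab.
  destruct HX as (x & _), HY as (y & _), HM as (Mid & _), HN as (Nid & _), HH as (Hid & Hcomp & Hinv).
  assert (E : sum_perm m n = fun c => sum_perm m (fun y => y) (sum_perm (fun x => x) n c))
    by (rewrite <- sum_perm_comp; reflexivity).
  rewrite E; apply Hcomp.
  - destruct j.
    + apply (generated_image M (fun m => sum_perm m (fun y => y))); auto using sum_perm_id.
      * repeat split; auto.
      * intros g h; now rewrite <- sum_perm_comp.
      * intros a s [Hs Ea]; apply Hstab; split; [do 2 eexists; eauto|].
        exists (inl a); simpl; now rewrite Ea.
    + apply Hstab; split; [do 2 eexists; eauto|now exists (inr y)].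
  - destruct j.
    + apply Hstab; split; [do 2 eexists; eauto|now exists (inl x)].
    + apply (generated_image N (fun n => sum_perm (fun x => x) n)); auto using sum_perm_id.
      * repeat split; auto.
      * intros g h; now rewrite <- sum_perm_comp.
      * intros a s [Hs Ea]; apply Hstab; split; [do 2 eexists; eauto|].
        exists (inr a); simpl; now rewrite Ea.
Qed.

Context {V : Type} {adj : V -> V -> Prop} {inVX : V -> Prop} {c : V -> V -> X + Y}.
Context (Htree : is_tree adj) (Hbip : bipartition adj inVX) (Hc : legal_colouring adj inVX c).

Lemma legal_colouring_neighbour v : exists u, adj v u.
Proof.
  destruct HX as (x & _), HY as (y & _), Hc as (H1 & H2 & _).
  destruct (classic (inVX v)) as [Hv|Hv].
  - destruct (proj2 (proj2 (H1 v Hv)) x) as (u & Hu & _); eauto.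
  - destruct (proj2 (proj2 (H2 v Hv)) y) as (u & Hu & _); eauto.
Qed.

Lemma terminus_colouring : exists col : V -> X + Y, forall u v, adj u v -> c u v = col v.
Proof.
  destruct (choice_function (fun v x => forall u, adj u v -> c u v = x)) as (col & Hcol); [|eauto].
  intros v; destruct (legal_colouring_neighbour v) as (u & Hu).
  exists (c u v); intros w Hw; apply Hc; [exact Hw|now apply (adj_sym Htree)].
Qed.

Context {col : V -> X + Y} (Hcol : forall u v, adj u v -> c u v = col v).

Lemma is_left_terminus u v : adj u v -> (is_left (col v) = true <-> inVX u).
Proof.
  intros Huv; rewrite <- (Hcol u v Huv); destruct Hc as (H1 & H2 & _).
  destruct (classic (inVX u)) as [Hu|Hu].
  - destruct (proj1 (H1 u Hu) v Huv) as (x & ->); simpl; tauto.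
  - destruct (proj1 (H2 u Hu) v Huv) as (y & ->); simpl; split; [discriminate|contradiction].
Qed.

(** A vertex bears the colour of its incoming arcs, which start on the other side of the
    bipartition; hence the negation. *)
Lemma is_left_terminus_col v : is_left (col v) = true <-> ~ inVX v.
Proof.
  destruct (legal_colouring_neighbour v) as (u & Hu); apply (adj_sym Htree) in Hu.
  rewrite (is_left_terminus u v Hu); now apply Hbip.
Qed.

Lemma legal_colouring_coloured_tree : coloured_tree adj col is_left (sum_group M N).
Proof.
  destruct Hc as (H1 & H2 & _); split.
  - exact Htree.
  - intros u v Huv E.
    pose proof (is_left_terminus u v Huv) as Hu; pose proof (is_left_terminus_col u) as Hu'.
    rewrite <- E in Hu; destruct (is_left (col u)); [|destruct (classic (inVX u))]; intuition discriminate.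
  - intros v u u' Hu Hu' E; rewrite <- !(Hcol v) in E by assumption.
    destruct (classic (inVX v)) as [Hv|Hv].
    + now apply (proj1 (proj2 (H1 v Hv))).
    + now apply (proj1 (proj2 (H2 v Hv))).
  - intros v d Hd; pose proof (is_left_terminus_col v) as Hv'.
    destruct (classic (inVX v)) as [Hv|Hv].
    + destruct d as [x|y].
      * destruct (proj2 (proj2 (H1 v Hv)) x) as (u & Hu & E); exists u.
        now rewrite <- (Hcol v).
      * exfalso; apply Hd; simpl; destruct (is_left (col v)); tauto.
    + destruct d as [x|y].
      * exfalso; apply Hd; simpl; symmetry; tauto.
      * destruct (proj2 (proj2 (H2 v Hv)) y) as (u & Hu & E); exists u.
        now rewrite <- (Hcol v).
  - destruct HX as (x & x' & Hx), HY as (y & y' & Hy).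
    intros []; [exists (inl x), (inl x')|exists (inr y), (inr y')]; repeat split; congruence.
  - exact sum_group_perm_group.
  - intros _ [] (m & n & _ & _ & ->); reflexivity.
  - intros _ _ (m & n & Hm & Hn & ->) (m' & n' & Hm' & Hn' & ->).
    exists m, n'; repeat split; auto.
    apply functional_extensionality; now intros [].
Qed.

Lemma U_c_local_group g : U_c adj inVX c M N g <-> local_group adj col (sum_group M N) g.
Proof.
  destruct HM as (Mid & _), HN as (Nid & _); pose proof legal_colouring_coloured_tree as HT.
  split.
  - intros (Hg & _ & HgX & HgY); split; [exact Hg|]; intros v.
    destruct (classic (inVX v)) as [Hv|Hv].
    + destruct (HgX v Hv) as (m & Hm & E).
      (* Neighbours of a vertex of [V_X] have colours in [X], so the second component is free and
         the identity serves. *)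
      exists (sum_perm m (fun y => y)); split; [do 2 eexists; eauto|].
      intros u Hu; pose proof (proj2 (is_left_terminus v u Hu) Hv) as Hl.
      rewrite <- (Hcol (g v) (g u)) by now apply (proj2 Hg v u).
      destruct (col u) as [x|y] eqn:Eu; [|discriminate].
      apply E; [exact Hu|now rewrite (Hcol v)].
    + destruct (HgY v Hv) as (n & Hn & E).
      exists (sum_perm (fun x => x) n); split; [do 2 eexists; eauto|].
      intros u Hu; pose proof (is_left_terminus v u Hu) as Hl.
      rewrite <- (Hcol (g v) (g u)) by now apply (proj2 Hg v u).
      destruct (col u) as [x|y] eqn:Eu; [simpl in Hl; tauto|].
      apply E; [exact Hu|now rewrite (Hcol v)].
  - intros Gg; pose proof Gg as [Hg HgL]; split; [exact Hg|split; [|split]].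
    + intros v; pose proof (local_group_kind HT g v Gg) as E.
      pose proof (is_left_terminus_col v) as H1; pose proof (is_left_terminus_col (g v)) as H2.
      rewrite E in H2; destruct (classic (inVX v)), (classic (inVX (g v))); tauto.
    + intros v _; destruct (HgL v) as (_ & (m & n & Hm & _ & ->) & E).
      exists m; split; [exact Hm|]; intros u x Hu Ex.
      rewrite (Hcol v) in Ex by exact Hu.
      rewrite (Hcol (g v)) by now apply (proj2 Hg v u).
      now rewrite E, Ex.
    + intros v _; destruct (HgL v) as (_ & (m & n & _ & Hn & ->) & E).
      exists n; split; [exact Hn|]; intros u y Hu Ey.
      rewrite (Hcol v) in Ey by exact Hu.
      rewrite (Hcol (g v)) by now apply (proj2 Hg v u).
      now rewrite E, Ey.
Qed.

Lemma U_c_eq_local_group : U_c adj inVX c M N = local_group adj col (sum_group M N).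
Proof.
  apply functional_extensionality; intros g; apply propositional_extensionality.
  apply U_c_local_group.
Qed.

Lemma VY_ext (a b : VY inVX) : proj1_sig a = proj1_sig b -> a = b.
Proof.
  destruct a as [a Ha], b as [b Hb]; simpl; intros <-; f_equal.
  apply functional_extensionality; intros H; contradiction.
Qed.

(* A vertex of [V_X] is the only common neighbour of two of its neighbours. *)
Lemma U_c_faithful g g' :
  U_c adj inVX c M N g -> U_c adj inVX c M N g' ->
  (forall v, ~ inVX v -> g v = g' v) -> g = g'.
Proof.
  intros Gg Gg' E; apply functional_extensionality; intros v.
  destruct (classic (inVX v)) as [Hv|Hv]; [|auto].
  pose proof legal_colouring_coloured_tree as HT.
  assert (Hadj : forall h a b, U_c adj inVX c M N h -> adj a b -> adj (h a) (h b))
    by (intros h a b Gh; now apply (proj2 (proj1 Gh) a b)).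
  pose proof (adj_sym Htree) as Hsym.
  destruct (neighbour HT v) as (u & Hu), (other_neighbour HT v u) as (w & Hw & Hne).
  assert (Hu' : ~ inVX u) by now apply (Hbip v u).
  assert (Hw' : ~ inVX w) by now apply (Hbip v w).
  pose proof (E u Hu') as Eu; pose proof (E w Hw') as Ew.
  assert (Hguw : g w <> g u).
  { destruct Gg as [[(h & Hhg & _) _] _]; intros Eg; apply Hne; now rewrite <- (Hhg w), Eg, Hhg. }
  assert (Hback : adj (g' v) (g u)) by (rewrite Eu; auto).
  symmetry; apply (half_root Htree (g u)); auto.
  apply half_step with (g w).
  - apply half_step with (g v); auto using half_base.
  - rewrite Ew; auto.
  - intros Eg; rewrite Eg in Hback; revert Hback; apply Htree.
Qed.

Lemma box_product_simple_iff :
  simple_perm_group (box_product adj inVX c M N) <-> simple_perm_group (U_c adj inVX c M N).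
Proof.
  set (R := fun (g : V -> V) (f : VY inVX -> VY inVX) => forall y, proj1_sig (f y) = g (proj1_sig y)).
  assert (UB : forall g, U_c adj inVX c M N g -> exists f, box_product adj inVX c M N f /\ R g f).
  { intros g Gg.
    assert (HgY : forall y : VY inVX, ~ inVX (g (proj1_sig y))).
    { intros [v Hv] H; apply Hv; now apply Gg. }
    exists (fun y => exist _ (g (proj1_sig y)) (HgY y)).
    split; [exists g; split; auto|]; now intros y. }
  assert (BU : forall f, box_product adj inVX c M N f -> exists g, U_c adj inVX c M N g /\ R g f) by auto.
  assert (Rinj : forall g g' f, U_c adj inVX c M N g -> U_c adj inVX c M N g' -> R g f -> R g' f -> g = g').
  { intros g g' f Gg Gg' Rg Rg'; apply U_c_faithful; auto.
    intros v Hv; transitivity (proj1_sig (f (exist _ v Hv))); [symmetry; apply Rg|apply Rg']. }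
  assert (Rfct : forall g f f', R g f -> R g f' -> f = f').
  { intros g f f' Rf Rf'; apply functional_extensionality; intros y.
    apply VY_ext; now rewrite (Rf y), (Rf' y). }
  assert (Rcomp : forall g g' f f', R g f -> R g' f' -> R (fun v => g (g' v)) (fun y => f (f' y)))
    by (intros g g' f f' Rg Rg' y; now rewrite Rg, Rg').
  assert (HU : perm_group (U_c adj inVX c M N)).
  { rewrite U_c_eq_local_group; exact (local_group_perm_group legal_colouring_coloured_tree). }
  destruct HU as (Uid & Ucomp & _).
  assert (Rid : R (fun v => v) (fun y => y)) by now intros y.
  split; [apply simple_perm_group_transfer with (fun f g => R g f)|
    apply simple_perm_group_transfer with R]; eauto.
  - exists (fun v => v); auto.
  - intros f f' (g & Gg & Rg) (g' & Gg' & Rg').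
    exists (fun v => g (g' v)); split; [now apply Ucomp|now apply Rcomp].
Qed.

End Box_product.

Theorem theorem4p5 (X Y : Type) (M : (X -> X) -> Prop) (N : (Y -> Y) -> Prop) :
  at_least_two X -> at_least_two Y ->
  perm_group M -> perm_group N ->
  gen_by_point_stabilisers M -> gen_by_point_stabilisers N ->
  (nontrivial M \/ nontrivial N) ->
  forall (V : Type) (adj : V -> V -> Prop) (inVX : V -> Prop) (c : V -> V -> X + Y),
    is_tree adj -> bipartition adj inVX -> legal_colouring adj inVX c ->
    (simple_perm_group (box_product adj inVX c M N) <-> (transitive M \/ transitive N)).
Proof.
  intros HX HY HM HN GM GN Hnt V adj inVX c Htree Hbip Hc.
  destruct (terminus_colouring HX HY Htree Hc) as (col & Hcol).
  pose proof (legal_colouring_coloured_tree HX HY HM HN Htree Hbip Hc Hcol) as HT.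
  rewrite (box_product_simple_iff HX HY HM HN Htree Hbip Hc Hcol),
    (U_c_eq_local_group HX HY HM HN Htree Hbip Hc Hcol).
  assert (Hmoves : exists t d, sum_group M N t /\ t d <> d).
  { destruct HM as (Mid & _), HN as (Nid & _).
    destruct Hnt as [(m & Hm & x & Hx)|(n & Hn & y & Hy)].
    - exists (sum_perm m (fun y => y)), (inl x); split; [do 2 eexists; eauto|simpl; congruence].
    - exists (sum_perm (fun x => x) n), (inr y); split; [do 2 eexists; eauto|simpl; congruence]. }
  destruct Hmoves as (t & d & Ht & Hd).
  pose proof (fun j s => sum_group_generated HX HY HM HN j s GM GN) as Hgen.
  destruct HM as (Mid & _), HN as (Nid & _).
  split.
  - intros Hsimple; apply NNPP; intros Hno; revert Hsimple.
    apply (local_group_not_simple HT t d); [|exact Ht|exact Hd].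
    intros [].
    + assert (H : exists a b, forall m, M m -> m a <> b).
      { apply NNPP; intros H; apply Hno; left; intros a b; apply NNPP; intros Hab.
        apply H; exists a, b; intros m Hm E; apply Hab; eauto. }
      destruct H as (a & b & Hab); exists (inl a), (inl b); repeat split.
      intros _ (m & n & Hm & _ & ->) [= E]; now apply (Hab m).
    + assert (H : exists a b, forall n, N n -> n a <> b).
      { apply NNPP; intros H; apply Hno; right; intros a b; apply NNPP; intros Hab.
        apply H; exists a, b; intros m Hm E; apply Hab; eauto. }
      destruct H as (a & b & Hab); exists (inr a), (inr b); repeat split.
      intros _ (m & n & _ & Hn & ->) [= E]; now apply (Hab n).
  - intros [Htr|Htr].
    + apply (local_group_simple HT true t d); auto.
      intros [a|a] [b|b] Ha Hb; try discriminate.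
      destruct (Htr a b) as (m & Hm & <-).
      exists (sum_perm m (fun y => y)); split; [do 2 eexists; eauto|reflexivity].
    + apply (local_group_simple HT false t d); auto.
      intros [a|a] [b|b] Ha Hb; try discriminate.
      destruct (Htr a b) as (n & Hn & <-).
      exists (sum_perm (fun x => x) n); split; [do 2 eexists; eauto|reflexivity].
Qed.
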